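(* Let $n\ge 1$ and let $$C^{n,1}=\{(z_0,\dots,z_n)\in\mathbb{C}^{n+1}: -|z_0|^2+|z_1|^2+\cdots+|z_n|^2<0\}.$$ Let $f=(f_0,f_1,\dots,f_n)$ be a biholomorphic self-map of $C^{n,1}$. Then there exist a nowhere vanishing holomorphic function $c$ on the unit ball $\mathbb{B}^n=\{w\in\mathbb{C}^n:|w_1|^2+\cdots+|w_n|^2<1\}$ and a matrix $(a_{ij})_{0\le i,j\le n}$ representing an element of $PU(n,1)$ such that either $$f_0(z_0,\dots,z_n)=c\Big(\frac{z_1}{z_0},\dots,\frac{z_n}{z_0}\Big)\,z_0\quad\text{for all } z\in C^{n,1},$$ or $$f_0(z_0,\dots,z_n)=c\Big(\frac{z_1}{z_0},\dots,\frac{z_n}{z_0}\Big)\,z_0^{-1}\quad\text{for all } z\in C^{n,1},$$ and, for $i=1,\dots,n$, $$f_i(z_0,\dots,z_n)=f_0(z_0,\dots,z_n)\,\frac{\sum_{j=0}^n a_{ij}z_j}{\sum_{j=0}^n a_{0j}z_j}.$$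
   Context: $U(n,1)=\{A\in GL(n+1,\mathbb{C}): A^*JA=J\}$ with $J=\mathrm{diag}(-1,1,\dots,1)$, and $PU(n,1)$ is its quotient by scalar matrices. Note $z_0\neq 0$ on $C^{n,1}$. *)

(* Defs.v *)
From HB Require Import structures.
From mathcomp Require Import all_boot all_order all_algebra.
From mathcomp Require Import reals.
From mathcomp Require Import complex.
Set Implicit Arguments. Unset Strict Implicit. Unset Printing Implicit Defensive.
Import Order.TTheory GRing.Theory Num.Theory.
Local Open Scope ring_scope.

Section Defs.
Variable R : realType.
Local Notation C := R[i].

Definition cmod (x : C) : R := ComplexField.Normc.normc x.

Definition vnorm (m : nat) (z : 'I_m -> C) : R := \sum_(i < m) cmod (z i).

Definition vadd (m : nat) (z h : 'I_m -> C) : 'I_m -> C := fun i => z i + h i.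

Definition holomorphic_on (m : nat) (U : ('I_m -> C) -> Prop)
    (f : ('I_m -> C) -> C) : Prop :=
  forall z, U z ->
  exists a : 'I_m -> C,
  forall eps : R, 0 < eps ->
  exists2 del : R, 0 < del &
  forall h : 'I_m -> C, vnorm h < del -> U (vadd z h) ->
    cmod (f (vadd z h) - f z - \sum_(i < m) a i * h i) <= eps * vnorm h.

Definition holomorphic_map_on (m : nat) (U : ('I_m -> C) -> Prop)
    (f : ('I_m -> C) -> ('I_m -> C)) : Prop :=
  forall i : 'I_m, holomorphic_on U (fun z => f z i).

Definition biholomorphic_self_map (m : nat) (U : ('I_m -> C) -> Prop)
    (f : ('I_m -> C) -> ('I_m -> C)) : Prop :=
  [/\ forall z, U z -> U (f z),
      holomorphic_map_on U f &
      exists g : ('I_m -> C) -> ('I_m -> C),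
        [/\ forall z, U z -> U (g z),
            holomorphic_map_on U g,
            forall z, U z -> g (f z) = z &
            forall z, U z -> f (g z) = z]].

Definition Cn1 (n : nat) : ('I_n.+1 -> C) -> Prop :=
  fun z => - cmod (z ord0) ^+ 2 + \sum_(i < n) cmod (z (lift ord0 i)) ^+ 2 < 0.

Definition ball_n (n : nat) : ('I_n -> C) -> Prop :=
  fun w => \sum_(i < n) cmod (w i) ^+ 2 < 1.

Definition Jmx (n : nat) : 'M[C]_n.+1 :=
  \matrix_(i, j) (if i == j then (if i == ord0 then -1 else 1) else 0).

Definition in_Un1 (n : nat) (A : 'M[C]_n.+1) : Prop :=
  (map_mx (@conjc R) A)^T *m Jmx n *m A = Jmx n.

End Defs.

(* Main.v *)
(** On each complex line through the origin the ratios f_i / f_0 are bounded on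
    the punctured plane, hence constant by Liouville: f descends to an
    automorphism of the ball, while f_0 restricts to an automorphism of the
    punctured plane on each fibre, that is s -> c s or s -> c / s; a connectedness
    argument shows that the exponent is the same on all fibres. After composing
    with a reflection of U(n,1), the ball map fixes the center, and the Schwarz
    lemma makes it isometric, then linear.

    Holomorphy only means pointwise complex differentiability, so the
    one-variable theory rests on Goursat's bisection argument, applied to
    zeta -> f (p + exp zeta) on rectangles of height 2 pi: circle means are
    constant, which gives the maximum principle, also in the presence of finitely
    many points where only continuity is known. Every further one-variable result
    is the maximum principle applied to iterated difference quotients. *)

Require Import Defs.
From HB Require Import structures.
From mathcomp Require Import all_boot all_order all_algebra.
From mathcomp Require Import reals.
From mathcomp Require Import complex.
From mathcomp Require Import boolp classical_sets topology normedtype derive.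
From mathcomp Require Import measure lebesgue_measure lebesgue_integral.
From mathcomp Require Import sequences exp trigo ring lra.
Set Implicit Arguments. Unset Strict Implicit. Unset Printing Implicit Defensive.
Import Order.TTheory GRing.Theory Num.Theory.
Import numFieldNormedType.Exports.
Local Open Scope ring_scope.

(** * Goursat's theorem on rectangles *)

Section RealIntegral.
Variable R : realType.
Implicit Types (f g : R -> R) (a b c x y e d : R).
Local Notation mu := (@lebesgue_measure R).

(** Goursat alone gives no removable singularity theorem: a difference quotient is known to be
    continuous at its base point, but not differentiable there. Allowing finitely many such points
    in the maximum principle lets quotients be fed back into it; this is why several one-variable
    lemmas below assume only continuity at 0. On a fibre, compactness excludes an essential
    singularity: the inverse map is bounded away from 0 on the annulus e <= |z| <= 1/e, so near 0
    the map avoids that annulus. A ball map fixing the centre preserves norms because Schwarz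
    applies to its inverse as well. It is linear because along a ray P(s) = F(s w) / s has constant
    squared norm N, so N - <P(s), P(0)> has nonnegative real part and vanishes at 0, hence
    everywhere; P(0) is the derivative, which is linear in w. Holomorphy in several variables is
    used through restrictions to complex lines, apart from the linearity of the derivative at the
    centre and the holomorphy of [c], which is f_0 on the section z_0 = 1. *)

Definition cont_at f x :=
  forall e : R, 0 < e -> exists2 d : R, 0 < d & forall y, `|y - x| < d -> `|f y - f x| < e.

Lemma cont_atP f x : cont_at f x -> {for x, continuous f}.
Proof.
move=> H; apply/cvgrPdist_lt => e e0; have [d d0 hd] := H e e0.
apply/nbhs_ballP; exists d => //= y; rewrite /ball /= distrC => /hd.
by rewrite distrC.
Qed.

Lemma cont_within f a b : (forall x, a <= x <= b -> cont_at f x) ->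
  {within `[a, b], continuous f}%classic.
Proof.
move=> H; apply: continuous_in_subspaceT => x; rewrite inE /= in_itv /= => hx.
exact/cont_atP/H.
Qed.

Lemma cont_atB f g x : cont_at f x -> cont_at g x -> cont_at (fun t => f t - g t) x.
Proof.
move=> hf hg e e0; have e2 : 0 < e / 2 by rewrite divr_gt0.
have [d1 d10 h1] := hf _ e2; have [d2 d20 h2] := hg _ e2.
exists (Num.min d1 d2); first by rewrite lt_min d10.
move=> y; rewrite lt_min => /andP[/h1 {}h1 /h2 {}h2].
have -> : f y - g y - (f x - g x) = (f y - f x) - (g y - g x) by ring.
by rewrite (le_lt_trans (ler_normB _ _))// [e]splitr ltrD.
Qed.

Definition itg f a b : R := \int[mu]_(x in `[a, b]) f x.

Lemma cont_integrable f a b : (forall x, a <= x <= b -> cont_at f x) ->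
  mu.-integrable `[a, b] (constructive_ereal.EFin \o f).
Proof.
move=> H; apply: continuous_compact_integrable; first exact: segment_compact.
exact: cont_within.
Qed.

Lemma itg_split f a b c : a <= b -> b <= c ->
  (forall x, a <= x <= c -> cont_at f x) -> itg f a c = itg f a b + itg f b c.
Proof.
move=> ab bc H; have H2 : forall x, b <= x <= c -> cont_at f x.
  by move=> x /andP[bx xc]; apply: H; rewrite xc (le_trans ab).
have := @Rintegral_itvB R f (BLeft a) (BRight c) b (cont_integrable H).
rewrite !bnd_simp => /(_ ab bc); rewrite Rintegral_itv_obnd_cbnd; last first.
  apply: integrableS (cont_integrable H2) => //.
  by move=> x /=; rewrite !in_itv /= => /andP[/ltW -> ->].
by rewrite /itg => <-; rewrite addrC subrK.
Qed.

Lemma itgB f g a b : (forall x, a <= x <= b -> cont_at f x) ->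
  (forall x, a <= x <= b -> cont_at g x) ->
  itg (fun x => f x - g x) a b = itg f a b - itg g a b.
Proof.
by move=> hf hg; rewrite /itg RintegralB//; exact: cont_integrable.
Qed.

Lemma itg_cst r a b : a <= b -> itg (fun=> r) a b = r * (b - a).
Proof.
rewrite /itg le_eqVlt => /predU1P[<-|ab].
  by rewrite set_itv1 Rintegral_set1 subrr mulr0.
rewrite Rintegral_cst//; congr (_ * _).
by have /= -> := lebesgue_measure_itv `[a, b]; rewrite constructive_ereal.lte_fin ab.
Qed.

Lemma cont_cst r x : cont_at (fun=> r) x.
Proof. by move=> e e0; exists 1 => // y _; rewrite subrr normr0. Qed.

Lemma itg_le f a b r : a <= b -> (forall x, a <= x <= b -> cont_at f x) ->
  (forall x, a <= x <= b -> f x <= r) -> itg f a b <= r * (b - a).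
Proof.
move=> ab hf h; rewrite -(itg_cst r ab) /itg; apply: le_Rintegral; first by [].
- exact: cont_integrable.
- by apply: cont_integrable => x _; exact: cont_cst.
- by move=> x /=; rewrite in_itv /= => /h.
Qed.

Lemma itg_ge f a b r : a <= b -> (forall x, a <= x <= b -> cont_at f x) ->
  (forall x, a <= x <= b -> r <= f x) -> r * (b - a) <= itg f a b.
Proof.
move=> ab hf h; rewrite -(itg_cst r ab) /itg; apply: le_Rintegral; first by [].
- by apply: cont_integrable => x _; exact: cont_cst.
- exact: cont_integrable.
- by move=> x /=; rewrite in_itv /= => /h.
Qed.

Lemma itg_near f a b r e : a <= b -> (forall x, a <= x <= b -> cont_at f x) ->
  (forall x, a <= x <= b -> `|f x - r| <= e) ->
  `|itg f a b - r * (b - a)| <= e * (b - a).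
Proof.
move=> ab hf h; rewrite ler_distl.
have h' x : a <= x <= b -> r - e <= f x <= r + e by move=> /h; rewrite ler_distl.
have -> : r * (b - a) - e * (b - a) = (r - e) * (b - a) by ring.
have -> : r * (b - a) + e * (b - a) = (r + e) * (b - a) by ring.
by rewrite itg_le ?itg_ge// => x /h' /andP[].
Qed.

End RealIntegral.

(** The supremum of the left endpoints works, since every left endpoint is at most every right
    endpoint. Intervals are given by left endpoint and width because the bisection fixes its widths
    in advance. *)
Lemma nested_intervals (R : realType) (s w : nat -> R) : (forall n, 0 <= w n) ->
  (forall n, s n <= s n.+1) -> (forall n, s n.+1 + w n.+1 <= s n + w n) ->
  exists x, forall n, s n <= x <= s n + w n.
Proof.
move=> w0 hs hw.
have inc m n : s m <= s (m + n)%N.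
  by elim: n => [|n IH]; rewrite ?addn0// addnS (le_trans IH).
have dec m n : s (m + n)%N + w (m + n)%N <= s m + w m.
  by elim: n => [|n IH]; rewrite ?addn0// addnS (le_trans _ IH).
have le m n : s m <= s n + w n.
  apply: le_trans (inc m n) _; apply: le_trans (dec n m).
  by rewrite addnC lerDl.
have hsup : has_sup (range s).
  by split; [exists (s 0%N), 0%N | exists (s 0%N + w 0%N) => _ [m _ <-]].
exists (sup (range s)) => n; apply/andP; split.
  by apply: sup_upper_bound => //; exists n.
by apply: ge_sup; [exact: hsup.1 | move=> _ [m _ <-]].
Qed.

Section Goursat.
Variable R : realType.
Implicit Types (u v : R -> R -> R) (x y e d del : R).

(** Real differentiability of [(u, v)] at one point, the derivative being multiplication by the
    complex number [al + i be]. *)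
Definition cauchy_riemann u v x0 y0 := exists al be : R,
  forall e : R, 0 < e -> exists2 d : R, 0 < d & forall x y, `|x - x0| + `|y - y0| < d ->
    `|u x y - u x0 y0 - (al * (x - x0) - be * (y - y0))|
      <= e * (`|x - x0| + `|y - y0|) /\
    `|v x y - v x0 y0 - (be * (x - x0) + al * (y - y0))|
      <= e * (`|x - x0| + `|y - y0|).

Lemma affine_cont (f : R -> R) (k x0 : R) :
  (forall e : R, 0 < e -> exists2 d : R, 0 < d & forall x, `|x - x0| < d ->
    `|f x - f x0 - k * (x - x0)| <= e * `|x - x0|) -> cont_at f x0.
Proof.
move=> H e e0; have [d d0 hd] := H 1 ltr01.
have k0 : 0 < `|k| + 1 by rewrite ltr_wpDl.
exists (Num.min d (e / (`|k| + 1))); first by rewrite lt_min d0 divr_gt0.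
move=> x; rewrite lt_min ltr_pdivlMr// => /andP[/hd {}hd h].
apply: le_lt_trans h.
have -> : f x - f x0 = (f x - f x0 - k * (x - x0)) + k * (x - x0) by ring.
rewrite (le_trans (ler_normD _ _))// normrM; move: hd; rewrite mul1r => hd.
rewrite [leRHS](_ : _ = `|x - x0| + `|k| * `|x - x0|); last by ring.
by rewrite lerD2r.
Qed.

Lemma cauchy_riemann_cont_u u v x0 y0 : cauchy_riemann u v x0 y0 -> cont_at (u x0) y0.
Proof.
move=> [al [be H]]; apply: (@affine_cont _ (- be)) => e /H[d d0 hd]; exists d => // y hy.
have := hd x0 y; rewrite subrr normr0 add0r => /(_ hy)[+ _].
by rewrite mulr0 sub0r mulNr.
Qed.

Lemma cauchy_riemann_cont_v u v x0 y0 :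
  cauchy_riemann u v x0 y0 -> cont_at (v^~ y0) x0.
Proof.
move=> [al [be H]]; apply: (@affine_cont _ be) => e /H[d d0 hd]; exists d => // x hx.
by have := hd x y0; rewrite subrr normr0 !mulr0 !addr0 => /(_ hx)[_].
Qed.

(* The imaginary part of the contour integral of u + iv along the rectangle. *)
Definition rect_itg u v x1 x2 y1 y2 : R :=
  itg (fun t => u x2 t - u x1 t) y1 y2 - itg (fun t => v t y2 - v t y1) x1 x2.

Variables (u v : R -> R -> R) (a b c d : R).
Hypothesis CR : forall x y, a <= x <= b -> c <= y <= d -> cauchy_riemann u v x y.

Let cu x y : a <= x <= b -> c <= y <= d -> cont_at (u x) y.
Proof. by move=> hx hy; exact: cauchy_riemann_cont_u (CR hx hy). Qed.
Let cv x y : a <= x <= b -> c <= y <= d -> cont_at (v^~ y) x.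
Proof. by move=> hx hy; exact: cauchy_riemann_cont_v (CR hx hy). Qed.

Lemma rect_itgE x1 x2 y1 y2 : a <= x1 <= b -> a <= x2 <= b -> c <= y1 <= d ->
  c <= y2 <= d -> rect_itg u v x1 x2 y1 y2 =
    itg (u x2) y1 y2 - itg (u x1) y1 y2
    - (itg (v^~ y2) x1 x2 - itg (v^~ y1) x1 x2).
Proof.
move=> /andP[a1 b1] /andP[a2 b2] /andP[c1 d1] /andP[c2 d2].
rewrite /rect_itg !itgB// => t /andP[t1 t2].
- by apply: cv; rewrite ?c2 ?d2// (le_trans a1)//= (le_trans t2).
- by apply: cv; rewrite ?c1 ?d1// (le_trans a1)//= (le_trans t2).
- by apply: cu; rewrite ?a2 ?b2// (le_trans c1)//= (le_trans t2).
- by apply: cu; rewrite ?a1 ?b1// (le_trans c1)//= (le_trans t2).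
Qed.

Lemma rect_itg_split x1 x2 x3 y1 y2 y3 :
  a <= x1 -> x1 <= x2 -> x2 <= x3 -> x3 <= b ->
  c <= y1 -> y1 <= y2 -> y2 <= y3 -> y3 <= d ->
  rect_itg u v x1 x3 y1 y3 = rect_itg u v x1 x2 y1 y2 + rect_itg u v x2 x3 y1 y2
   + rect_itg u v x1 x2 y2 y3 + rect_itg u v x2 x3 y2 y3.
Proof.
move=> a1 x12 x23 b3 c1 y12 y23 d3.
have ax2 := le_trans a1 x12; have ax3 := le_trans ax2 x23.
have bx2 := le_trans x23 b3; have bx1 := le_trans x12 bx2.
have cy2 := le_trans c1 y12; have cy3 := le_trans cy2 y23.
have dy2 := le_trans y23 d3; have dy1 := le_trans y12 dy2.
have spu x : a <= x <= b -> itg (u x) y1 y3 = itg (u x) y1 y2 + itg (u x) y2 y3.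
  move=> hx; apply: itg_split => // t /andP[t1 t2]; apply: cu => //.
  by rewrite (le_trans c1)//= (le_trans t2).
have spv y : c <= y <= d ->
    itg (v^~ y) x1 x3 = itg (v^~ y) x1 x2 + itg (v^~ y) x2 x3.
  move=> hy; apply: itg_split => // t /andP[t1 t2]; apply: cv => //.
  by rewrite (le_trans a1)//= (le_trans t2).
rewrite !rect_itgE ?a1 ?bx1 ?ax2 ?bx2 ?ax3 ?b3 ?c1 ?dy1 ?cy2 ?dy2 ?cy3 ?d3//.
rewrite !spu ?a1 ?bx1 ?ax2 ?bx2 ?ax3 ?b3// !spv ?c1 ?dy1 ?cy2 ?dy2 ?cy3 ?d3//.
ring.
Qed.

(** The affine part of u + iv contributes [al * (x2 - x1) * (y2 - y1)] to both integrals and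
    cancels. The remainder is at most [e / 2 * h] on each edge, where [h] is half the perimeter. *)
Lemma rect_itg_near x0 y0 e : a <= x0 <= b -> c <= y0 <= d -> 0 < e ->
  exists2 del : R, 0 < del & forall x1 x2 y1 y2 (h := x2 - x1 + (y2 - y1)),
    a <= x1 -> x1 <= x0 -> x0 <= x2 -> x2 <= b ->
    c <= y1 -> y1 <= y0 -> y0 <= y2 -> y2 <= d -> h < del ->
    `|rect_itg u v x1 x2 y1 y2| <= e * h ^+ 2.
Proof.
move=> hx0 hy0 e0; have [al [be H]] := CR hx0 hy0.
have e2 : 0 < e / 2 by rewrite divr_gt0.
have [del del0 hd] := H _ e2; exists del => // x1 x2 y1 y2 h a1 x10 x02 b2.
move=> c1 y10 y02 d2 hh.
have close x y : x1 <= x <= x2 -> y1 <= y <= y2 -> `|x - x0| + `|y - y0| <= h.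
  move=> /andP[xx1 xx2] /andP[yy1 yy2]; rewrite /h; apply: lerD.
    by rewrite ler_norml; apply/andP; split; lra.
  by rewrite ler_norml; apply/andP; split; lra.
have est x y : x1 <= x <= x2 -> y1 <= y <= y2 ->
    `|u x y - u x0 y0 - (al * (x - x0) - be * (y - y0))| <= e / 2 * h /\
    `|v x y - v x0 y0 - (be * (x - x0) + al * (y - y0))| <= e / 2 * h.
  move=> hx hy; have cl := close _ _ hx hy.
  have [A B] := hd x y (le_lt_trans cl hh).
  split; [apply: (le_trans A)|apply: (le_trans B)]; exact: ler_wpM2l (ltW e2) _ _ cl.
have xx : x1 <= x2 by exact: le_trans x02.
have yy : y1 <= y2 by exact: le_trans y02.
have I1 : `|itg (fun t => u x2 t - u x1 t) y1 y2 - al * (x2 - x1) * (y2 - y1)|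
    <= (e * h) * (y2 - y1).
  apply: itg_near => // t /andP[t1 t2].
    have ht : c <= t <= d by rewrite (le_trans c1)//= (le_trans t2).
    by apply: cont_atB; apply: cu => //; rewrite ?b2 ?a1 ?(le_trans a1)// (le_trans _ b2).
  have ht : y1 <= t <= y2 by rewrite t1.
  have [|A' _] := est x2 t _ ht; first by rewrite lexx xx.
  have [|B' _] := est x1 t _ ht; first by rewrite lexx xx.
  by move: A' B'; rewrite !ler_norml => /andP[? ?] /andP[? ?]; apply/andP; split; lra.
have I2 : `|itg (fun t => v t y2 - v t y1) x1 x2 - al * (y2 - y1) * (x2 - x1)|
    <= (e * h) * (x2 - x1).
  apply: itg_near => // t /andP[t1 t2].
    have ht : a <= t <= b by rewrite (le_trans a1)//= (le_trans t2).
    by apply: cont_atB; apply: cv => //; rewrite ?d2 ?c1 ?(le_trans c1)// (le_trans _ d2).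
  have ht : x1 <= t <= x2 by rewrite t1.
  have [|_ A'] := est t y2 ht; first by rewrite lexx yy.
  have [|_ B'] := est t y1 ht; first by rewrite lexx yy.
  by move: A' B'; rewrite !ler_norml => /andP[? ?] /andP[? ?]; apply/andP; split; lra.
have -> : rect_itg u v x1 x2 y1 y2 =
  (itg (fun t => u x2 t - u x1 t) y1 y2 - al * (x2 - x1) * (y2 - y1)) -
  (itg (fun t => v t y2 - v t y1) x1 x2 - al * (y2 - y1) * (x2 - x1)).
  by rewrite /rect_itg; ring.
apply: (le_trans (ler_normB _ _)); apply: (le_trans (lerD I1 I2)).
rewrite le_eqVlt; apply/orP; left; apply/eqP; rewrite /h; ring.
Qed.

(** Goursat's bisection: some quarter keeps at least a quarter of the modulus, so step n retains K /
    4^n. At the limit point [rect_itg_near] bounds the same integral by an arbitrarily small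
    multiple of 4^-n. *)
Lemma rect_itg_eq0 : a <= b -> c <= d -> rect_itg u v a b c d = 0.
Proof.
move=> ab cd; apply/eqP; apply: contraT => E0.
pose wx n := (b - a) / 2 ^+ n; pose wy n := (d - c) / 2 ^+ n.
have p20 n : 0 < 2 ^+ n :> R by rewrite exprn_gt0.
have wxS n : wx n = wx n.+1 + wx n.+1.
  rewrite /wx exprS; field; exact: lt0r_neq0.
have wyS n : wy n = wy n.+1 + wy n.+1.
  rewrite /wy exprS; field; exact: lt0r_neq0.
have wx0 n : 0 <= wx n by rewrite /wx divr_ge0 ?subr_ge0// ltW.
have wy0 n : 0 <= wy n by rewrite /wy divr_ge0 ?subr_ge0// ltW.
set K := `|rect_itg u v a b c d|.
have K0 : 0 < K by rewrite normr_gt0.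
pose Q n (p : R * R) := [/\ a <= p.1, p.1 + wx n <= b, c <= p.2, p.2 + wy n <= d &
  K / 4 ^+ n <= `|rect_itg u v p.1 (p.1 + wx n) p.2 (p.2 + wy n)|].
have p40 n : 0 < 4 ^+ n :> R by rewrite exprn_gt0.
(* [Q] stands under the existential so that [choice] yields a function on all pairs; outside [Q] the
   witness is arbitrary. *)
have step (np : nat * (R * R)) : exists p', Q np.1 np.2 ->
    [/\ Q np.1.+1 p', np.2.1 <= p'.1, np.2.2 <= p'.2,
     p'.1 + wx np.1.+1 <= np.2.1 + wx np.1 & p'.2 + wy np.1.+1 <= np.2.2 + wy np.1].
  case: np => n [x y] /=.
  case: (pselect (Q n (x, y))) => [[/= h1 h2 h3 h4 h5]|]; last by exists (x, y).
  have k1 : x <= x + wx n.+1 by rewrite lerDl.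
  have k2 : y <= y + wy n.+1 by rewrite lerDl.
  have k3 : x + wx n.+1 <= x + wx n by rewrite lerD2l [leRHS]wxS lerDl.
  have k4 : y + wy n.+1 <= y + wy n by rewrite lerD2l [leRHS]wyS lerDl.
  have := rect_itg_split h1 k1 k3 h2 h3 k2 k4 h4.
  set E1 := rect_itg _ _ _ _ _ _; set E2 := rect_itg _ _ _ _ _ _.
  set E3 := rect_itg _ _ _ _ _ _; set E4 := rect_itg _ _ _ _ _ _.
  set E5 := rect_itg _ _ _ _ _ _ => EE.
  have ex : x + wx n.+1 + wx n.+1 = x + wx n by rewrite -addrA -wxS.
  have ey : y + wy n.+1 + wy n.+1 = y + wy n by rewrite -addrA -wyS.
  have q4 : K / 4 ^+ n = 4 * (K / 4 ^+ n.+1).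
    rewrite exprS; field; exact: lt0r_neq0.
  pose M := K / 4 ^+ n.+1.
  have h5' : 4 * M <= `|E1| by rewrite /M -q4.
  have /orP : (M <= `|E2|) || (M <= `|E3|) || (M <= `|E4|) || (M <= `|E5|).
    rewrite !leNgt -!negb_and; apply/negP => /andP[/andP[/andP[f2 f3] f4] f5].
    have : `|E1| <= `|E2| + `|E3| + `|E4| + `|E5|.
      by rewrite EE (le_trans (ler_normD _ _))// lerD2r (le_trans (ler_normD _ _))//
        lerD2r ler_normD.
    lra.
  have b1 := le_trans k3 h2; have b2 := le_trans k4 h4.
  have a1 := le_trans h1 k1; have a2 := le_trans h3 k2.
  case=> [/orP[/orP[]|]|] hE.
  - by exists (x, y); split => //=; split.
  - by exists (x + wx n.+1, y); split => //=; rewrite ?ex//; split; rewrite /= ?ex.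
  - by exists (x, y + wy n.+1); split => //=; rewrite ?ey//; split; rewrite /= ?ey.
  - by exists (x + wx n.+1, y + wy n.+1); split => //=; rewrite ?ex ?ey//; split;
      rewrite /= ?ex ?ey.
have [nx hnx] := choice step.
pose p := fix p n := if n is m.+1 then nx (m, p m) else (a, c).
have Qp n : Q n (p n).
  elim: n => [|n IH]; last by case: (hnx (n, p n) IH).
  by rewrite /Q /wx /wy /= !expr0 !divr1 !subrKC.
have st n := hnx (n, p n) (Qp n).
have [x hx] : exists x, forall n, (p n).1 <= x <= (p n).1 + wx n.
  by apply: nested_intervals => // n; case: (st n).
have [y hy] : exists y, forall n, (p n).2 <= y <= (p n).2 + wy n.
  by apply: nested_intervals => // n; case: (st n).
have px n : (p n).1 + wx n - (p n).1 = wx n by ring.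
have py n : (p n).2 + wy n - (p n).2 = wy n by ring.
pose D := (b - a) + (d - c).
have D0 : 0 <= D by rewrite addr_ge0 ?subr_ge0.
have D1 : 0 < D ^+ 2 + 1 by rewrite ltr_wpDl ?sqr_ge0.
have hx0 := hx 0%N; have hy0 := hy 0%N.
(* With this constant the upper bound becomes K / 4^n times D^2 / (2 (D^2 + 1)), a factor below 1.
   The added 1 covers a rectangle with D = 0. *)
have [del del0 hdel] : exists2 del : R, 0 < del & forall x1 x2 y1 y2 (h := x2 - x1 + (y2 - y1)),
    a <= x1 -> x1 <= x -> x <= x2 -> x2 <= b ->
    c <= y1 -> y1 <= y -> y <= y2 -> y2 <= d -> h < del ->
    `|rect_itg u v x1 x2 y1 y2| <= (K / (2 * (D ^+ 2 + 1))) * h ^+ 2.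
  apply: rect_itg_near.
  - by move: hx0; rewrite /wx /= expr0 divr1 subrKC.
  - by move: hy0; rewrite /wy /= expr0 divr1 subrKC.
  - by rewrite divr_gt0// mulr_gt0.
have [n hn] : exists n, D / del < 2 ^+ n.
  exists (Num.bound (D / del)); apply: upper_nthrootP => //.
have [Q1 Q2 Q3 Q4 Q5] := Qp n.
have /andP[x1 x2] := hx n; have /andP[y1 y2] := hy n.
have hD : wx n + wy n = D / 2 ^+ n by rewrite /wx /wy -mulrDl.
have := hdel _ _ _ _ Q1 x1 x2 Q2 Q3 y1 y2 Q4.
rewrite px py hD => /(_ _)H.
have {H} : `|rect_itg u v (p n).1 ((p n).1 + wx n) (p n).2 ((p n).2 + wy n)| <=
    K / (2 * (D ^+ 2 + 1)) * (D / 2 ^+ n) ^+ 2.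
  by apply: H; rewrite ltr_pdivrMr// mulrC -ltr_pdivrMr.
move/(le_trans Q5).
have -> : K / (2 * (D ^+ 2 + 1)) * (D / 2 ^+ n) ^+ 2 =
    (K / 4 ^+ n) * (D ^+ 2 / (2 * (D ^+ 2 + 1))).
  have -> : 4 ^+ n = 2 ^+ n * 2 ^+ n :> R by rewrite -exprMn; congr (_ ^+ n); ring.
  by field; rewrite !lt0r_neq0.
rewrite -[leLHS]mulr1 ler_pM2l ?divr_gt0// ler_pdivlMr ?mulr_gt0//.
lra.
Qed.

End Goursat.

(** * Complex differentiability *)

Section ComplexCalculus.
Variable R : realType.
Local Notation C := R[i].
Implicit Types (s z p : C) (k f g q : C -> C) (e d r : R).

Lemma cmodM s z : cmod (s * z) = cmod s * cmod z.
Proof. exact: ComplexField.Normc.normcM. Qed.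
Lemma cmodD s z : cmod (s + z) <= cmod s + cmod z.
Proof. exact: le_normcD. Qed.
Lemma cmodN s : cmod (- s) = cmod s.
Proof. exact: normcN. Qed.
Lemma cmodV s : cmod s^-1 = (cmod s)^-1.
Proof. exact: ComplexField.Normc.normcV. Qed.
Lemma cmod0 : cmod (0 : C) = 0.
Proof. exact: ComplexField.Normc.normc0. Qed.
Lemma cmod1 : cmod (1 : C) = 1.
Proof. exact: ComplexField.Normc.normc1. Qed.
Lemma cmod_eq0 s : (cmod s == 0) = (s == 0).
Proof.
apply/eqP/eqP => [|->]; [exact: ComplexField.Normc.eq0_normc|exact: cmod0].
Qed.
Lemma cmod_ge0 s : 0 <= cmod s.
Proof. by case: s => a b; exact: sqrtr_ge0. Qed.
Lemma cmod_gt0 s : (0 < cmod s) = (s != 0).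
Proof. by rewrite lt_def cmod_ge0 andbT cmod_eq0. Qed.
Lemma cmodB s z : cmod (s - z) = cmod (z - s).
Proof. by rewrite -cmodN opprB. Qed.
Lemma cmodBle s z : cmod (s - z) <= cmod s + cmod z.
Proof. by rewrite (le_trans (cmodD _ _))// cmodN. Qed.
Lemma cmod_subl s z : cmod s - cmod z <= cmod (s - z).
Proof. by rewrite lerBlDr -{1}(subrK z s) cmodD. Qed.
Lemma cmodX s n : cmod (s ^+ n) = cmod s ^+ n.
Proof. by elim: n => [|n IH]; rewrite ?expr0 ?cmod1// !exprS cmodM IH. Qed.

Lemma cmod_sqr s : cmod s ^+ 2 = complex.Re s ^+ 2 + complex.Im s ^+ 2.
Proof. by case: s => a b; rewrite sqr_sqrtr// addr_ge0 ?sqr_ge0. Qed.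

Lemma cmod_real (x : R) : cmod (x%:C)%C = `|x|.
Proof. by rewrite /cmod /= expr0n /= addr0 sqrtr_sqr. Qed.

Lemma cmodC s : cmod (s^*)%C = cmod s.
Proof. by case: s => a b; rewrite /cmod /= sqrrN. Qed.

Lemma mul_conjc s : s * (s^*)%C = ((cmod s ^+ 2)%:C)%C.
Proof.
rewrite cmod_sqr; case: s => a b; apply/eqP; rewrite eq_complex /=.
by apply/andP; split; apply/eqP; ring.
Qed.

Lemma normr_Re_cmod s : `|complex.Re s| <= cmod s.
Proof.
rewrite -(ler_pXn2r (n:=2)) ?nnegrE ?cmod_ge0// cmod_sqr.
by rewrite real_normK ?num_real// lerDl sqr_ge0.
Qed.

Lemma normr_Im_cmod s : `|complex.Im s| <= cmod s.
Proof.
rewrite -(ler_pXn2r (n:=2)) ?nnegrE ?cmod_ge0// cmod_sqr.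
by rewrite real_normK ?num_real// lerDr sqr_ge0.
Qed.

Lemma cmod_le_ReIm s : cmod s <= `|complex.Re s| + `|complex.Im s|.
Proof.
rewrite -(ler_pXn2r (n:=2)) ?nnegrE ?cmod_ge0 ?addr_ge0// cmod_sqr sqrrD.
by rewrite !real_normK ?num_real// -addrA lerD2l lerDr mulrn_wge0 ?mulr_ge0.
Qed.

Lemma ReD s z : complex.Re (s + z) = complex.Re s + complex.Re z.
Proof. by case: s z => a b [c d']. Qed.
Lemma ReB s z : complex.Re (s - z) = complex.Re s - complex.Re z.
Proof. by case: s z => a b [c d']. Qed.
Lemma ImB s z : complex.Im (s - z) = complex.Im s - complex.Im z.
Proof. by case: s z => a b [c d']. Qed.
Lemma Re_le_cmod s : complex.Re s <= cmod s.
Proof. exact: le_trans (ler_norm _) (normr_Re_cmod s). Qed.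

Definition ccont k z := forall e, 0 < e ->
  exists2 d : R, 0 < d & forall s, cmod (s - z) < d -> cmod (k s - k z) < e.

(* Caratheodory's formulation: [q] is the difference quotient of [k] at [z]. *)
Definition cdiff k z := exists q, ccont q z /\ forall s, k s = k z + q s * (s - z).

Lemma ccont_near f g z r : 0 < r -> (forall s, cmod (s - z) < r -> f s = g s) ->
  ccont f z -> ccont g z.
Proof.
move=> r0 fg H e /H[d d0 hd]; exists (Num.min d r); first by rewrite lt_min d0.
move=> s; rewrite lt_min => /andP[sd sr].
by rewrite -!fg ?subrr ?cmod0//; exact: hd.
Qed.

Lemma ccont_cst z p : ccont (fun=> p) z.
Proof. by move=> e e0; exists 1 => // s _; rewrite subrr cmod0. Qed.
Lemma ccont_id z : ccont id z.
Proof. by move=> e e0; exists e. Qed.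

Lemma ccontD f g z : ccont f z -> ccont g z -> ccont (fun s => f s + g s) z.
Proof.
move=> hf hg e e0; have e2 : 0 < e / 2 by rewrite divr_gt0.
have [d1 d10 h1] := hf _ e2; have [d2 d20 h2] := hg _ e2.
exists (Num.min d1 d2); first by rewrite lt_min d10.
move=> y; rewrite lt_min => /andP[/h1 {}h1 /h2 {}h2].
rewrite opprD addrACA.
by rewrite (le_lt_trans (cmodD _ _))// [e]splitr ltrD.
Qed.

Lemma ccont_bound f z : ccont f z -> exists M d : R, [/\ 0 < M, 0 < d &
  forall s, cmod (s - z) < d -> cmod (f s) <= M].
Proof.
move=> /(_ 1 ltr01)[d d0 hd]; exists (cmod (f z) + 1), d; split => //.
  by rewrite ltr_wpDl ?cmod_ge0.
move=> s /hd h; rewrite -(subrK (f z) (f s)) (le_trans (cmodD _ _))//.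
by rewrite addrC lerD2l ltW.
Qed.

Lemma ccontM f g z : ccont f z -> ccont g z -> ccont (fun s => f s * g s) z.
Proof.
move=> hf hg e e0; have [M [d0 [M0 d00 hM]]] := ccont_bound hf.
have N1 : 0 < cmod (g z) + 1 by rewrite ltr_wpDl ?cmod_ge0.
have [d1 d10 h1] := hf (e / 2 / (cmod (g z) + 1)) ltac:(by rewrite !divr_gt0).
have [d2 d20 h2] := hg (e / 2 / M) ltac:(by rewrite !divr_gt0).
exists (Num.min d0 (Num.min d1 d2)); first by rewrite !lt_min d00 d10.
move=> y; rewrite !lt_min => /and3P[/hM {}hM /h1 {}h1 /h2 {}h2].
have -> : f y * g y - f z * g z = f y * (g y - g z) + (f y - f z) * g z by ring.
rewrite (le_lt_trans (cmodD _ _))// !cmodM [e]splitr; apply: ltr_leD.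
  apply: le_lt_trans (ler_wpM2r (cmod_ge0 _) hM) _.
  by rewrite mulrC -ltr_pdivlMr.
rewrite ltr_pdivlMr// in h1; apply: ltW; apply: le_lt_trans h1.
by rewrite ler_wpM2l ?cmod_ge0// lerDl.
Qed.

Lemma ccontN f z : ccont f z -> ccont (fun s => - f s) z.
Proof.
by move=> H e /H[d d0 hd]; exists d => // s /hd; rewrite -opprD cmodN.
Qed.

Lemma ccontB f g z : ccont f z -> ccont g z -> ccont (fun s => f s - g s) z.
Proof. by move=> hf hg; apply: ccontD => //; exact: ccontN. Qed.

Lemma ccontV f z : f z != 0 -> ccont f z -> ccont (fun s => (f s)^-1) z.
Proof.
move=> fz0 hf e e0; have m0 : 0 < cmod (f z) by rewrite cmod_gt0.
have m2 : 0 < cmod (f z) / 2 by rewrite divr_gt0.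
have [d1 d10 h1] := hf _ m2.
have [d2 d20 h2] := hf (e * (cmod (f z) / 2) * cmod (f z)) (mulr_gt0 (mulr_gt0 e0 m2) m0).
exists (Num.min d1 d2); first by rewrite lt_min d10.
move=> s; rewrite lt_min => /andP[/h1 {}h1 /h2 {}h2].
have ms : cmod (f z) / 2 < cmod (f s).
  have h3 := cmod_subl (f z) (f s); rewrite (cmodB (f z)) in h3; lra.
have ms0 := lt_trans m2 ms; have fs0 : f s != 0 by rewrite -cmod_gt0.
have -> : (f s)^-1 - (f z)^-1 = (f z - f s) / (f s * f z) by field; rewrite fs0 fz0.
rewrite cmodM cmodV cmodB cmodM ltr_pdivrMr ?mulr_gt0//.
by apply: lt_le_trans h2 _; rewrite [leRHS]mulrA ler_wpM2r ?cmod_ge0 ?ler_wpM2l ?ltW.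
Qed.

Lemma ccont_comp f g z : ccont g z -> ccont f (g z) -> ccont (fun s => f (g s)) z.
Proof. by move=> hg hf e /hf[d /hg[d' d'0 h'] h]; exists d' => // s /h' /h. Qed.

Lemma ccont_conj f z : ccont f z -> ccont (fun s => (f s)^*%C) z.
Proof. by move=> H e /H[d d0 hd]; exists d => // s /hd; rewrite -rmorphB /= cmodC. Qed.

Lemma ccont_sum (I : finType) (F : I -> C -> C) z : (forall i, ccont (F i) z) ->
  ccont (fun s => \sum_i F i s) z.
Proof.
move=> H; elim: (index_enum I) => [|i l IH].
  apply: (@ccont_near (fun=> 0) _ z 1) => // [s _|]; first by rewrite big_nil.
  exact: ccont_cst.
apply: (@ccont_near (fun s => F i s + \sum_(j <- l) F j s) _ z 1) => // [s _|].
  by rewrite big_cons.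
exact: ccontD.
Qed.

(** [cdiff] asks for an identity valid at all [s]; a quotient known only near [z] is made global by
    taking the true difference quotient off [z]. *)
Lemma cdiffI f q z r : 0 < r -> ccont q z ->
  (forall s, cmod (s - z) < r -> f s = f z + q s * (s - z)) -> cdiff f z.
Proof.
move=> r0 cq H; pose q' s := if s == z then q z else (f s - f z) / (s - z).
exists q'; split.
  apply: (ccont_near r0 _ cq) => s /H hs; rewrite /q'; case: eqVneq => [->//|sz].
  by rewrite hs addrC addKr mulfK// subr_eq0.
move=> s; rewrite /q'; case: eqVneq => [->|sz]; first by rewrite subrr mulr0 addr0.
by rewrite divfK ?subr_eq0// subrKC.
Qed.

Lemma cdiff_near f g z r : 0 < r -> (forall s, cmod (s - z) < r -> f s = g s) ->
  cdiff f z -> cdiff g z.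
Proof.
move=> r0 fg [q [cq H]]; apply: (cdiffI r0 cq) => s hs.
by rewrite -!fg ?subrr ?cmod0.
Qed.

Lemma cdiff_cont f z : cdiff f z -> ccont f z.
Proof.
move=> [q [cq H]]; apply: (@ccont_near (fun s => f z + q s * (s - z)) _ z 1) => //.
apply: ccontD; first exact: ccont_cst.
by apply: ccontM => //; apply: ccontB; [exact: ccont_id|exact: ccont_cst].
Qed.

Lemma cdiff_cst z p : cdiff (fun=> p) z.
Proof. by exists (fun=> 0); split => [|s]; [exact: ccont_cst|rewrite mul0r addr0]. Qed.
Lemma cdiff_id z : cdiff id z.
Proof. by exists (fun=> 1); split => [|s]; [exact: ccont_cst|rewrite mul1r subrKC]. Qed.

Lemma cdiffD f g z : cdiff f z -> cdiff g z -> cdiff (fun s => f s + g s) z.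
Proof.
move=> [p [cp hp]] [q [cq hq]]; exists (fun s => p s + q s); split; first exact: ccontD.
by move=> s; rewrite hp hq; ring.
Qed.

Lemma cdiffM f g z : cdiff f z -> cdiff g z -> cdiff (fun s => f s * g s) z.
Proof.
move=> hf hg; have cg := cdiff_cont hg; case: hf hg => [p [cp hp]] [q [cq hq]].
exists (fun s => p s * g s + f z * q s); split.
  by apply: ccontD; apply: ccontM => //; exact: ccont_cst.
by move=> s; rewrite [f s]hp [g s]hq; ring.
Qed.

Lemma cdiffN f z : cdiff f z -> cdiff (fun s => - f s) z.
Proof.
move=> [p [cp hp]]; exists (fun s => - p s); split; first exact: ccontN.
by move=> s; rewrite hp; ring.
Qed.

Lemma cdiffB f g z : cdiff f z -> cdiff g z -> cdiff (fun s => f s - g s) z.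
Proof. by move=> hf hg; apply: cdiffD => //; exact: cdiffN. Qed.

Lemma ccont_neq0 f z : ccont f z -> f z != 0 ->
  exists2 r, 0 < r & forall s, cmod (s - z) < r -> f s != 0.
Proof.
move=> cf fz0; have [|r r0 hr] := cf (cmod (f z)); first by rewrite cmod_gt0.
exists r => // s /hr; apply: contraTneq => ->.
by rewrite sub0r cmodN ltxx.
Qed.

Lemma cdiffV f z : f z != 0 -> cdiff f z -> cdiff (fun s => (f s)^-1) z.
Proof.
move=> fz0 hf; have cf := cdiff_cont hf; case: hf => [p [cp hp]].
have [r r0 hr] := ccont_neq0 cf fz0.
apply: (@cdiffI _ (fun s => - (p s * ((f s)^-1 * (f z)^-1))) z r) => //.
  apply: ccontN; apply: ccontM => //; apply: ccontM; last exact: ccont_cst.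
  exact: ccontV.
move=> s /hr fs0; have h : p s * (s - z) = f s - f z by rewrite [f s]hp; ring.
rewrite (_ : - _ * _ = - (p s * (s - z)) * ((f s)^-1 * (f z)^-1)); last by ring.
by rewrite h; field; rewrite fs0 fz0.
Qed.

Lemma cdiff_div f g z : cdiff f z -> cdiff g z -> g z != 0 ->
  cdiff (fun s => f s / g s) z.
Proof. by move=> hf hg g0; apply: cdiffM => //; exact: cdiffV. Qed.

Lemma cdiff_comp f g z : cdiff g z -> cdiff f (g z) -> cdiff (fun s => f (g s)) z.
Proof.
move=> hg; have cg := cdiff_cont hg; case: hg => q [cq hq] [p [cp hp]].
exists (fun s => p (g s) * q s); split.
  by apply: ccontM => //; exact: ccont_comp.
move=> s; have h : g s - g z = q s * (s - z) by rewrite [g s]hq; ring.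
by rewrite hp h mulrA.
Qed.

Lemma cdiff_sum (I : finType) (F : I -> C -> C) z : (forall i, cdiff (F i) z) ->
  cdiff (fun s => \sum_i F i s) z.
Proof.
move=> H; elim: (index_enum I) => [|i l IH].
  apply: (@cdiff_near (fun=> 0) _ z 1) => // [s _|]; first by rewrite big_nil.
  exact: cdiff_cst.
apply: (@cdiff_near (fun s => F i s + \sum_(j <- l) F j s) _ z 1) => // [s _|].
  by rewrite big_cons.
exact: cdiffD.
Qed.

(** From the epsilon-delta derivative to Caratheodory's form. The value [q z = a] is recorded
    because the derivative at the centre of the ball is needed explicitly. *)
Lemma cdiffP k z (a : C) :
  (forall e, 0 < e -> exists2 d : R, 0 < d & forall s, cmod (s - z) < d ->
    cmod (k s - k z - a * (s - z)) <= e * cmod (s - z)) ->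
  exists2 q, ccont q z /\ q z = a & forall s, k s = k z + q s * (s - z).
Proof.
move=> H; exists (fun s => if s == z then a else (k s - k z) / (s - z)); last first.
  move=> s; case: eqVneq => [->|sz]; first by rewrite subrr mulr0 addr0.
  by rewrite divfK ?subr_eq0// subrKC.
rewrite eqxx; split => // e e0.
have e2 : 0 < e / 2 by rewrite divr_gt0.
have [d d0 hd] := H _ e2; exists d => // s /hd.
rewrite eqxx; case: eqVneq => [_ _|sz]; first by rewrite subrr cmod0.
have m0 : 0 < cmod (s - z) by rewrite cmod_gt0 subr_eq0.
have -> : (k s - k z) / (s - z) - a = (k s - k z - a * (s - z)) / (s - z).
  by field; rewrite subr_eq0.
rewrite cmodM cmodV -ler_pdivrMr// => /le_lt_trans; apply.
by rewrite ltr_pdivrMr// ltr_pMr// ltr1n.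
Qed.

End ComplexCalculus.

(** * Circle means and the maximum principle *)

Section ComplexExponential.
Variable R : realType.
Local Notation C := R[i].
Implicit Types (s z p : C) (e d r : R).

Lemma is_derive_expansion (f : R -> R) (x df : R) : is_derive x 1 f df ->
  forall e, 0 < e -> exists2 d : R, 0 < d & forall h : R, `|h| < d ->
    `|f (x + h) - f x - df * h| <= e * `|h|.
Proof.
move=> [ex val] e e0; move: ex; rewrite /derivable => ex.
have : (h^-1 *: ((f \o shift x) (h *: 1) - f x) @[h --> 0^'] --> df)%classic.
  by rewrite -val.
move=> /cvgrPdist_le/(_ _ e0); rewrite /dnbhs /= => /nbhs_ballP[d /= d0 hd].
exists d => // h hh; have [->|h0] := eqVneq h 0.
  by rewrite addr0 subrr mulr0 subr0 normr0 mulr0.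
have := hd h; rewrite /ball /= sub0r normrN => /(_ hh h0).
rewrite /GRing.scale /= mulr1 [h + x]addrC => H.
have -> : f (x + h) - f x - df * h = - ((df - h^-1 * (f (x + h) - f x)) * h) by field.
by rewrite normrN normrM ler_wpM2r.
Qed.

Definition cexp z : C :=
  ((expR (complex.Re z) * cos (complex.Im z)) +i*
   (expR (complex.Re z) * sin (complex.Im z)))%C.

Lemma cexpD s z : cexp (s + z) = cexp s * cexp z.
Proof.
case: s z => a b [c d']; apply/eqP; rewrite eq_complex /= expRD cosD sinD.
by apply/andP; split; apply/eqP; ring.
Qed.

Lemma cmod_cexp z : cmod (cexp z) = expR (complex.Re z).
Proof.
case: z => x y; rewrite /cmod /cexp /= !exprMn -mulrDr cos2Dsin2 mulr1.
by rewrite sqrtr_sqr ger0_norm// expR_ge0.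
Qed.

Lemma cexp0 : cexp 0 = 1.
Proof. by rewrite /cexp /= expR0 cos0 sin0 mulr0 mulr1. Qed.

Lemma cdiff_cexp0 : cdiff cexp 0.
Proof.
suff H : forall e, 0 < e -> exists2 d : R, 0 < d & forall s, cmod (s - 0) < d ->
    cmod (cexp s - cexp 0 - 1 * (s - 0)) <= e * cmod (s - 0).
  by have [q [cq _] hq] := cdiffP H; exists q.
(* The real part has error at most 4 t m and the imaginary part 5 t m, so t <= e / 20 is ample. The
   bound t <= 1 serves to keep |a|, |b| <= 1 and |E| <= 3. *)
move=> e e0; pose t := Num.min 1 (e / 20).
have t0 : 0 < t by rewrite lt_min ltr01 divr_gt0.
have t1 : t <= 1 by rewrite ge_min lexx.
have te : t <= e / 20 by rewrite ge_min lexx orbT.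
clearbody t.
have [d1 d10 h1] := is_derive_expansion (is_derive_expR 0) t0.
have [d2 d20 h2] := is_derive_expansion (is_derive_cos 0) t0.
have [d3 d30 h3] := is_derive_expansion (is_derive_sin 0) t0.
exists (Num.min t (Num.min d1 (Num.min d2 d3))); first by rewrite !lt_min t0 d10 d20 d30.
case=> a b; rewrite !subr0 !lt_min => /and4P[ht hs1 hs2 hs3].
have ha := normr_Re_cmod (a +i* b)%C; have hb := normr_Im_cmod (a +i* b)%C.
set m := cmod _ in ht hs1 hs2 hs3 ha hb *; rewrite /= in ha hb.
have := h1 a (le_lt_trans ha hs1); have := h2 b (le_lt_trans hb hs2).
have := h3 b (le_lt_trans hb hs3).
rewrite !add0r expR0 cos0 sin0 oppr0 !mul0r !subr0 !mul1r ?addr0.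
set S := sin b; set K := cos b; set E := expR a => g3 g2 g1.
have g3' : `|S - b| <= t * m by apply: le_trans g3 _; rewrite ler_wpM2l// ltW.
have g2' : `|K - 1| <= t * m by apply: le_trans g2 _; rewrite ler_wpM2l// ltW.
have g1' : `|E - 1 - a| <= t * m by apply: le_trans g1 _; rewrite ler_wpM2l// ltW.
have m0 : 0 <= m by exact: le_trans hb.
have K1 : `|K| <= 1 by rewrite ler_norml cos_geN1 cos_le1.
have E3 : `|E| <= 3.
  have -> : E = (E - 1 - a) + 1 + a by ring.
  rewrite (le_trans (ler_normD _ _))//.
  have := ler_normD (E - 1 - a) 1; rewrite normr1 => q.
  have tm : t * m <= 1 by rewrite -[leRHS]mul1r ler_pM// ?ltW// (lt_le_trans ht).
  have m1 : m <= 1 by rewrite (le_trans (ltW ht)).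
  lra.
have EK : `|E * K - 1 - a| <= 4 * t * m.
  have -> : E * K - 1 - a = E * (K - 1) + (E - 1 - a) by ring.
  rewrite (le_trans (ler_normD _ _))// normrM.
  have := ler_pM (normr_ge0 _) (normr_ge0 _) E3 g2'; lra.
have ES : `|E * S - b| <= 5 * t * m.
  have -> : E * S - b = E * (S - b) + (E - 1 - a) * b + a * b by ring.
  rewrite (le_trans (ler_normD _ _))// (le_trans (lerD (ler_normD _ _) (lexx _)))//.
  rewrite !normrM.
  have q1 := ler_pM (normr_ge0 _) (normr_ge0 _) E3 g3'.
  have q2 : `|E - 1 - a| * `|b| <= t * m * 1.
    by apply: ler_pM => //; apply: le_trans hb _; rewrite (le_trans (ltW ht)).
  have q3 : `|a| * `|b| <= t * m.
    by apply: ler_pM => //; rewrite (le_trans ha)// ltW.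
  lra.
rewrite cexp0; apply: le_trans (cmod_le_ReIm _) _.
rewrite /= -/E -/K -/S oppr0 addr0.
have tem : t * m <= e / 20 * m by rewrite ler_wpM2r.
have := mulr_ge0 (ltW e0) m0.
lra.
Qed.

Lemma cdiff_cexp z : cdiff cexp z.
Proof.
apply: (@cdiff_near _ (fun s => cexp z * cexp (s - z)) _ z 1) => //.
  by move=> s _; rewrite -cexpD subrKC.
apply: cdiffM; first exact: cdiff_cst.
apply: (@cdiff_comp _ cexp (fun s => s - z)).
  by apply: cdiffB; [exact: cdiff_id|exact: cdiff_cst].
by rewrite subrr; exact: cdiff_cexp0.
Qed.

Lemma cdiff_cauchy_riemann (k : C -> C) (x0 y0 : R) : cdiff k (x0 +i* y0)%C ->
  cauchy_riemann (fun x y => complex.Re (k (x +i* y)%C))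
                 (fun x y => complex.Im (k (x +i* y)%C)) x0 y0.
Proof.
set z0 := (x0 +i* y0)%C => -[q [cq hq]].
exists (complex.Re (q z0)), (complex.Im (q z0)) => e e0.
have [d d0 hd] := cq e e0; exists d => // x y hxy.
have hz : cmod ((x +i* y)%C - z0) <= `|x - x0| + `|y - y0| by exact: cmod_le_ReIm.
have := hd (x +i* y)%C (le_lt_trans hz hxy).
set z := (x +i* y)%C in hz * => hqz.
have E : cmod (k z - k z0 - q z0 * (z - z0)) <= e * (`|x - x0| + `|y - y0|).
  have -> : k z - k z0 - q z0 * (z - z0) = (q z - q z0) * (z - z0).
    by rewrite [k z]hq; ring.
  by rewrite cmodM; apply: ler_pM; rewrite ?cmod_ge0// ltW.
have E1 := le_trans (normr_Re_cmod _) E; have E2 := le_trans (normr_Im_cmod _) E.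
split; [move: E1|move: E2]; rewrite /z0 /z.
  by rewrite !ReB; case: (q (x0 +i* y0)%C) => a b /=.
rewrite !ImB; case: (q (x0 +i* y0)%C) => a b /=.
by rewrite (addrC (a * _)).
Qed.

(** Pulled back by s -> p + exp s, the annulus becomes a rectangle of height 2 pi. By periodicity
    the horizontal sides cancel, and the vertical sides are the integrals of Re k over the two
    circles. *)
Lemma circle_itg_const (k : C -> C) p (a b : R) : a <= b ->
  (forall s, expR a <= cmod (s - p) <= expR b -> cdiff k s) ->
  let u x y := complex.Re (k (p + cexp (x +i* y)%C)) in
  (forall x, a <= x <= b -> forall y, cont_at (u x) y) /\
  itg (u a) 0 (2 * pi) = itg (u b) 0 (2 * pi).
Proof.
move=> ab H u; pose v x y := complex.Im (k (p + cexp (x +i* y)%C)).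
have CR x y : a <= x <= b -> cauchy_riemann u v x y.
  move=> /andP[ax xb]; apply: (@cdiff_cauchy_riemann (fun s => k (p + cexp s))).
  apply: (@cdiff_comp _ k (fun s => p + cexp s)).
    by apply: cdiffD; [exact: cdiff_cst|exact: cdiff_cexp].
  by apply: H; rewrite addrC addKr cmod_cexp /= !ler_expR ax.
have cu x : a <= x <= b -> forall y, cont_at (u x) y.
  by move=> hx y; exact: cauchy_riemann_cont_u (CR x y hx).
split=> //; have pi2 : 0 <= 2 * pi :> R by rewrite mulr_ge0// pi_ge0.
have := @rect_itg_eq0 R u v a b 0 (2 * pi) (fun x y hx _ => CR x y hx) ab pi2.
rewrite /rect_itg (_ : itg (fun t => v t _ - _) _ _ = 0).
  have ca y : cont_at (u a) y by apply: cu; rewrite lexx.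
  have cb y : cont_at (u b) y by apply: cu; rewrite lexx ab.
  by rewrite subr0 itgB// => /eqP; rewrite subr_eq0 => /eqP.
rewrite (_ : (fun t => _) = fun=> 0) ?itg_cst ?mul0r//.
apply/funext => t; rewrite /v /cexp /= mulr_natl cos2pi sin2pi cos0 sin0 subrr//.
Qed.

(** On the circle of radius r / 2 the mean of Re k is at most Re k(p) - eta; on a circle small
    enough for continuity at [p] it is at least Re k(p) - eta / 2. The two means agree, and the
    annulus between the circles does not contain [p]. *)
Lemma no_strict_peak (k : C -> C) p (e r : R) : 0 < e -> 0 < r -> ccont k p ->
  (forall s, 0 < cmod (s - p) < r -> cdiff k s) ->
  ~ (forall s, cmod (s - p) < r ->
       complex.Re (k s) + e * cmod (s - p) ^+ 2 <= complex.Re (k p)).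
Proof.
move=> e0 r0 kp kd H.
have r2 : 0 < r / 2 by rewrite divr_gt0.
pose eta := e * (r / 2) ^+ 2.
have eta0 : 0 < eta / 2 by rewrite divr_gt0// mulr_gt0// exprn_gt0.
have [d d0 hd] := kp _ eta0.
pose m := Num.min (d / 2) (r / 2).
have m0 : 0 < m by rewrite lt_min r2 divr_gt0.
have md : m < d by rewrite gt_min ltr_pdivrMr// ltr_pMr// ltr1n.
have lnm : expR (ln m) = m by rewrite lnK.
have lnr : expR (ln (r / 2)) = r / 2 by rewrite lnK.
have ab : ln m <= ln (r / 2) by rewrite ler_ln ?posrE// ge_min lexx orbT.
have [|cu] := @circle_itg_const k p _ _ ab.
  move=> s; rewrite lnm lnr => /andP[h1 h2]; apply: kd; rewrite (lt_le_trans m0)//=.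
  by rewrite (le_lt_trans h2)// ltr_pdivrMr// ltr_pMr// ltr1n.
have pi2 : 0 < 2 * pi :> R by rewrite mulr_gt0// pi_gt0.
apply/eqP; rewrite gt_eqF//.
apply: (@le_lt_trans _ _ ((complex.Re (k p) - eta) * (2 * pi - 0))).
  apply: itg_le => [|y _|y _]; first exact: ltW.
    by apply: cu; rewrite ab lexx.
  have := H (p + cexp (ln (r / 2) +i* y)%C); rewrite addrC addKr cmod_cexp /= lnr.
  rewrite ltr_pdivrMr// ltr_pMr// ltr1n => /(_ isT); rewrite -/eta addrC; lra.
apply: (@lt_le_trans _ _ ((complex.Re (k p) - eta / 2) * (2 * pi - 0))).
  by rewrite subr0 ltr_pM2r//; move: eta0; lra.
apply: itg_ge => [|y _|y _]; first exact: ltW.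
  by apply: cu; rewrite ab lexx.
have := hd (p + cexp (ln m +i* y)%C); rewrite addrC addKr cmod_cexp /= lnm => /(_ md).
move=> /ltW/(le_trans (normr_Re_cmod _)); rewrite ReB addrC ler_norml; lra.
Qed.

End ComplexExponential.

Section MaximumPrinciple.
Variable R : realType.
Local Notation C := R[i].
Implicit Types (s z p a : C) (k h q : C -> C) (e d r M : R) (E : seq C).

Definition rcont (g : C -> R) z := forall e, 0 < e ->
  exists2 d : R, 0 < d & forall s, cmod (s - z) < d -> `|g s - g z| < e.

Lemma rcont_prod (g : C -> R) (x : R * R) : rcont g (x.1 +i* x.2)%C ->
  {for x, continuous (fun y : R * R => g (y.1 +i* y.2)%C)}.
Proof.
move=> H; apply/cvgrPdist_lt => e e0; have [d d0 hd] := H e e0.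
apply/(@nbhs_ballP R (R * R)%type); exists (d / 2) => /=; first by rewrite divr_gt0.
move=> y [/= h1 h2]; rewrite distrC; apply: hd.
apply: le_lt_trans (cmod_le_ReIm _) _ => /=; rewrite [d]splitr.
by apply: ltrD; rewrite distrC.
Qed.

Lemma rcont_cmod (k : C -> C) z : ccont k z -> rcont (fun s => cmod (k s)) z.
Proof.
move=> H e /H[d d0 hd]; exists d => // s /hd; apply: le_lt_trans.
rewrite ler_norml lerNl opprB cmod_subl andbT cmodB; exact: cmod_subl.
Qed.

(** For [lo = 0] this is a closed disc, as in the maximum principle; a positive [lo] serves for
    annuli around the puncture. *)
Lemma annulus_max (g : C -> R) (lo hi : R) : 0 <= lo -> lo <= hi ->
  (forall z, lo <= cmod z <= hi -> rcont g z) ->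
  exists2 p, lo <= cmod p <= hi & forall z, lo <= cmod z <= hi -> g z <= g p.
Proof.
move=> lo0 lohi H.
pose A : set (R * R) := [set x | lo <= cmod (x.1 +i* x.2)%C <= hi]%classic.
have cA : compact A.
  apply: (@subclosed_compact _ _ (`[- hi, hi] `*` `[- hi, hi])%classic).
  - have -> : A = ((fun y : (R * R)%type => cmod (y.1 +i* y.2)%C) @^-1` `[lo, hi])%classic.
      by apply/seteqP; split => x /=; rewrite in_itv.
    apply: closed_comp; last exact: itv_closed.
    by move=> x _; apply: (@rcont_prod (fun z => cmod z)); apply: rcont_cmod; exact: ccont_id.
  - by apply: compact_setX; exact: segment_compact.
  - move=> x /= /andP[_ hx]; rewrite !in_itv /= -!ler_norml.
    split; apply: le_trans hx; [exact: (normr_Re_cmod (x.1 +i* x.2)%C)|].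
    exact: (normr_Im_cmod (x.1 +i* x.2)%C).
have A0 : (A !=set0)%classic.
  exists (hi, 0); rewrite /A /mkset -[(_ +i* _)%C]/((hi%:C)%C) cmod_real.
  by rewrite ger0_norm ?lohi ?lexx// (le_trans lo0).
have [|[x y] + hc] := @compact_EVT_max _ R (fun y : R * R => g (y.1 +i* y.2)%C) A A0 cA.
  apply: continuous_in_subspaceT => x; rewrite inE => hx.
  exact/rcont_prod/H.
rewrite inE => hx; exists (x +i* y)%C => // -[u v] huv.
by apply: (hc (u, v)); rewrite inE.
Qed.

Lemma avoid_finite E p : exists2 r, 0 < r & forall s, 0 < cmod (s - p) < r -> s \notin E.
Proof.
elim: E => [|x E [r r0 IH]]; first by exists 1.
have [->|xp] := eqVneq x p.
  exists r => // s /andP[s0 sr]; rewrite inE negb_or IH ?s0// andbT.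
  by rewrite -subr_eq0 -cmod_gt0.
exists (Num.min r (cmod (x - p))); first by rewrite lt_min r0 cmod_gt0 subr_eq0.
move=> s; rewrite lt_min => /and3P[s0 sr sx]; rewrite inE negb_or IH ?s0// andbT.
by apply: contraTneq sx => ->; rewrite ltxx.
Qed.

(** If |k z0| > M, rotate so that [c * k z0] is real and positive, and add e |s|^2 to Re (c k). The
    maximum of the sum is then interior, and after a linear correction it becomes a strict peak,
    excluded by [no_strict_peak] even when it lies in [E]. *)
Lemma max_modulus k E r M : 0 < r ->
  (forall z, cmod z <= r -> ccont k z) ->
  (forall z, cmod z < r -> z \notin E -> cdiff k z) ->
  (forall z, cmod z = r -> cmod (k z) <= M) ->
  forall z, cmod z <= r -> cmod (k z) <= M.
Proof.
move=> r0 kc kd kM z0 hz0; rewrite leNgt; apply/negP => Mk.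
have M0 : 0 <= M by apply: le_trans (kM (r%:C)%C _); rewrite ?cmod_ge0// cmod_real gtr0_norm.
set m := cmod (k z0) in Mk.
have m0 : 0 < m by exact: le_lt_trans Mk.
pose c := (k z0)^*%C / ((m)%:C)%C.
have mC0 : ((m%:C)%C : C) != 0 by rewrite -cmod_gt0 cmod_real gtr0_norm.
have c1 : cmod c = 1.
  by rewrite /c cmodM cmodV cmodC cmod_real gtr0_norm// divff ?gt_eqF.
have ck : c * k z0 = (m%:C)%C.
  rewrite /c mulrAC [_ * k z0]mulrC mul_conjc -/m expr2 rmorphM /=.
  by rewrite mulfK.
(* Chosen so that on the boundary [g] is at most M + e r^2 < m <= g z0, which forces the maximum
   inside. *)
pose e := (m - M) / (2 * r ^+ 2).
have r20 : 0 < r ^+ 2 by rewrite exprn_gt0.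
have e0 : 0 < e by rewrite divr_gt0 ?subr_gt0// mulr_gt0.
have er : e * r ^+ 2 < m - M.
  have -> : e * r ^+ 2 = (m - M) / 2 by rewrite /e; field; exact: lt0r_neq0.
  by rewrite ltr_pdivrMr// ltr_pMr ?subr_gt0// ltr1n.
pose g s := complex.Re (c * k s) + e * cmod s ^+ 2.
have gc z : 0 <= cmod z <= r -> rcont g z.
  move=> /andP[_ hz] eta eta0; have eta2 : 0 < eta / 2 by rewrite divr_gt0.
  have [d d0 hd] := ccontM (ccont_cst z c) (kc _ hz) eta2.
  have cid2 := ccontM (ccont_id z) (ccont_id z).
  have [d' d'0 hd'] := rcont_cmod cid2 (divr_gt0 eta2 e0).
  exists (Num.min d d'); first by rewrite lt_min d0.
  move=> s; rewrite lt_min => /andP[/hd h1 /hd' h2].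
  rewrite /g opprD addrACA (le_lt_trans (ler_normD _ _))// [eta]splitr ltrD//.
    by apply: le_lt_trans h1; rewrite -ReB; exact: normr_Re_cmod.
  rewrite -mulrBr normrM gtr0_norm// mulrC -ltr_pdivlMr//.
  by move: h2; rewrite !cmodM -!expr2.
have [p /andP[_ pr] pmax] := @annulus_max g 0 r (lexx _) (ltW r0) gc.
have gz0 : m <= g z0.
  by rewrite /g ck /= lerDl mulr_ge0 ?sqr_ge0// ltW.
have pr' : cmod p < r.
  rewrite lt_neqAle pr andbT; apply/eqP => pE.
  have : g z0 <= g p by apply: pmax; rewrite cmod_ge0.
  have : complex.Re (c * k p) <= M.
    by apply: le_trans (Re_le_cmod _) _; rewrite cmodM c1 mul1r kM.
  rewrite /g pE -/(g z0); lra.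
have [r1 r10 hr1] := avoid_finite E p.
pose r2 := Num.min r1 (r - cmod p).
have r20' : 0 < r2 by rewrite lt_min r10 subr_gt0.
have inr s : cmod (s - p) < r2 -> cmod s < r.
  rewrite lt_min => /andP[_ h]; rewrite -(subrK p s) (le_lt_trans (cmodD _ _))//.
  by rewrite -ltrBrDr.
(* In |s|^2 = |p|^2 + |s - p|^2 + 2 Re (conj p (s - p)) the last term is the real part of a
   holomorphic function. Absorbed into [F], it leaves exactly the term e |s - p|^2. *)
pose F s := c * k s + ((2 * e)%:C)%C * (p^*)%C * (s - p).
have cF z : ccont k z -> ccont F z.
  move=> kz; apply: ccontD; apply: ccontM => //; try exact: ccont_cst.
  by apply: ccontB; [exact: ccont_id|exact: ccont_cst].
apply: (@no_strict_peak _ F p e r2 e0 r20'); first exact/cF/kc/ltW.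
- move=> s /andP[s0 s2]; apply: cdiffD; apply: cdiffM; try exact: cdiff_cst.
    apply: kd; first exact: inr.
    by apply: hr1; move: s2; rewrite s0 lt_min => /andP[].
  by apply: cdiffB; [exact: cdiff_id|exact: cdiff_cst].
move=> s /inr hs; have : g s <= g p by apply: pmax; rewrite cmod_ge0 ltW.
rewrite /g /F subrr mulr0 addr0 ReD.
have -> : cmod s ^+ 2 = cmod p ^+ 2 + cmod (s - p) ^+ 2
    + 2 * complex.Re ((p^*)%C * (s - p)).
  by rewrite !cmod_sqr; case: (s) (p) => [a b] [a' b'] /=; ring.
have -> : complex.Re (((2 * e)%:C)%C * (p^*)%C * (s - p)) =
    2 * e * complex.Re ((p^*)%C * (s - p)).
  by rewrite -mulrA; case: (_ * (s - p)) => a b /=; ring.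
lra.
Qed.

End MaximumPrinciple.

(** * Difference quotients, Liouville and Schwarz *)

Section OneVariable.
Variable R : realType.
Local Notation C := R[i].
Implicit Types (s z p a b w : C) (k h q S T : C -> C) (e d r M : R) (E : seq C).

(** The quotient is only continuous at [a], so each use of it adds the base point to the exceptional
    set of the maximum principle. *)
Lemma diff_quotient k a : cdiff k a -> exists q,
  [/\ ccont q a, forall s, k s = k a + q s * (s - a),
      forall s, s != a -> ccont k s -> ccont q s &
      forall s, s != a -> cdiff k s -> cdiff q s].
Proof.
move=> [q [cq hq]]; exists q; split=> // s sa.
- have sa0 : 0 < cmod (s - a) by rewrite cmod_gt0 subr_eq0.
  move=> ks; apply: (@ccont_near _ (fun z => (k z - k a) / (z - a)) _ s _ sa0).
    move=> z hz; rewrite hq addrC addKr mulfK// subr_eq0.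
    by apply: contraTneq hz => ->; rewrite cmodB ltxx.
  apply: ccontM; first by apply: ccontB => //; exact: ccont_cst.
  apply: ccontV; first by rewrite subr_eq0.
  by apply: ccontB; [exact: ccont_id|exact: ccont_cst].
- have sa0 : 0 < cmod (s - a) by rewrite cmod_gt0 subr_eq0.
  move=> ks; apply: (@cdiff_near _ (fun z => (k z - k a) / (z - a)) _ s _ sa0).
    move=> z hz; rewrite hq addrC addKr mulfK// subr_eq0.
    by apply: contraTneq hz => ->; rewrite cmodB ltxx.
  apply: cdiff_div; rewrite ?subr_eq0//.
    by apply: cdiffB => //; exact: cdiff_cst.
  by apply: cdiffB; [exact: cdiff_id|exact: cdiff_cst].
Qed.

Lemma quotient_cmod k q a s (c : R) : k s = k a + q s * (s - a) -> 0 < c ->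
  c <= cmod (s - a) -> cmod (q s) <= (cmod (k s) + cmod (k a)) / c.
Proof.
move=> hk c0 hc; rewrite ler_pdivlMr//.
apply: le_trans (cmodBle (k s) (k a)).
by rewrite hk [k a + _]addrC addrK cmodM ler_wpM2l ?cmod_ge0.
Qed.

(** As 0 may be exceptional, the quotient is based at [a] and evaluated at 0, where k 0 = 0 gives k
    a = q 0 * a. On |s| = r one has |s - a| >= r / 2, whence the bound 2M / (r / 2). *)
Lemma lipschitz_at0 k E r M : 0 < r -> 0 < M ->
  (forall s, cmod s <= r -> ccont k s) ->
  (forall s, cmod s < r -> s \notin E -> cdiff k s) ->
  (forall s, cmod s <= r -> cmod (k s) <= M) -> k 0 = 0 ->
  forall a, a \notin E -> cmod a <= r / 2 -> cmod (k a) <= 4 * M / r * cmod a.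
Proof.
move=> r0 M0 kc kd kM k0 a aE ar.
have r2 : r / 2 < r by rewrite ltr_pdivrMr// ltr_pMr// ltr1n.
have [q [q1 q2 q3 q4]] := diff_quotient (kd a (le_lt_trans ar r2) aE).
have H0 : cmod (q 0) <= 4 * M / r.
  apply: (@max_modulus _ q (a :: E) r _ r0); rewrite ?cmod0 ?ltW// => s.
  - have [->//|sa hs] := eqVneq s a; apply: q3 => //; exact: kc.
  - rewrite inE negb_or => hs /andP[sa sE]; apply: q4 => //; exact: kd.
  - move=> hs; have hsa : r / 2 <= cmod (s - a).
      have := cmod_subl s a; rewrite hs; lra.
    apply: le_trans (quotient_cmod (q2 s) _ hsa) _; first by rewrite divr_gt0.
    have -> : 4 * M / r = (M + M) / (r / 2) by field; exact: lt0r_neq0.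
    rewrite ler_pM2r ?invr_gt0 ?divr_gt0//; apply: lerD; apply: kM; rewrite ?hs//.
    by rewrite (le_trans ar)// ltW.
have := q2 0; rewrite k0 sub0r mulrN => /esym/eqP; rewrite subr_eq0 => /eqP ->.
by rewrite cmodM ler_wpM2r ?cmod_ge0.
Qed.

Lemma vanish_at_infinity k E : (forall s, ccont k s) ->
  (forall s, s \notin E -> cdiff k s) ->
  (forall e, 0 < e -> exists r, forall s, r < cmod s -> cmod (k s) <= e) ->
  forall s, k s = 0.
Proof.
move=> kc kd H s; apply/eqP; rewrite -cmod_eq0; apply: contraT => ks.
have ks0 : 0 < cmod (k s) by rewrite lt_def ks cmod_ge0.
have [r hr] := H _ (divr_gt0 ks0 (ltr0Sn _ 1)).
pose r1 := Num.max r (cmod s) + 1.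
have sr1 : cmod s < r1 by rewrite ltr_pwDr// le_max lexx orbT.
have rr1 : r < r1 by rewrite ltr_pwDr// le_max lexx.
have := @max_modulus _ k E r1 (cmod (k s) / 2) (le_lt_trans (cmod_ge0 s) sr1).
move=> /(_ (fun s _ => kc s) (fun s _ => kd s)) H1.
have := H1 _ s (ltW sr1); rewrite leNgt ltr_pdivrMr// ltr_pMr// ltr1n => H2.
by suff : false by []; apply: H2 => z hz; apply: hr; rewrite hz.
Qed.

(** Liouville: the difference quotient of a function bounded near infinity tends to 0 there, hence
    vanishes by the maximum principle on large circles. *)
Lemma bounded_const k E (r M : R) : (forall s, ccont k s) ->
  (forall s, s \notin E -> cdiff k s) ->
  (forall s, r < cmod s -> cmod (k s) <= M) ->
  forall a, a \notin E -> forall s, k s = k a.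
Proof.
move=> kc kd H a aE s; have [q [q1 q2 q3 q4]] := diff_quotient (kd a aE).
suff q0 : forall s, q s = 0 by rewrite q2 q0 mul0r addr0.
apply: (@vanish_at_infinity q (a :: E)).
- by move=> z; have [->//|za] := eqVneq z a; apply: q3.
- by move=> z; rewrite inE negb_or => /andP[za zE]; apply: q4 => //; exact: kd.
- move=> e e0; pose N := `|M| + cmod (k a).
  have N0 : 0 <= N by rewrite addr_ge0 ?cmod_ge0.
  exists (Num.max r (cmod a + (N + 1) / e)) => z; rewrite gt_max => /andP[/H hM hz].
  have h0 : 0 < (N + 1) / e by rewrite divr_gt0// ltr_wpDl.
  have h1 : (N + 1) / e <= cmod (z - a).
    have := cmod_subl z a; lra.
  apply: le_trans (quotient_cmod (q2 z) h0 h1) _.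
  rewrite ler_pdivrMr// mulrC divfK ?gt_eqF//.
  have := ler_norm M; rewrite /N; lra.
Qed.

(** The quotient is based at 1 because differentiability at 0 is unknown. It is bounded for |z| > 2,
    where |z - 1| >= |z| / 2, hence constant. *)
Lemma linear_growth k (M B : R) : (forall s, ccont k s) ->
  (forall s, s != 0 -> cdiff k s) -> 0 <= M -> 0 <= B ->
  (forall s, cmod (k s) <= M * cmod s + B) ->
  exists al be : C, forall s, k s = al + be * s.
Proof.
move=> kc kd M0 B0 H.
have k1 : cdiff k 1 by apply: kd; rewrite oner_eq0.
have [q [q1 q2 q3 q4]] := diff_quotient k1.
have qc s : q s = q 2.
  (* The reference point 2 is a choice outside the exceptional points 0 and 1. The bound is
     generous: the estimate itself gives 2M + B + |k 1|. *)
  apply: (@bounded_const q [:: 0; 1] 2 (3 * M + 3 * B + cmod (k 1))).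
  - by move=> z; have [->//|za] := eqVneq z 1; apply: q3.
  - by move=> z; rewrite !inE negb_or => /andP[z0 z1]; apply: q4 => //; exact: kd.
  - move=> z hz; have hc : cmod z / 2 <= cmod (z - 1).
      have := cmod_subl z 1; rewrite cmod1; lra.
    have c0 : 0 < cmod z / 2 by rewrite divr_gt0// (lt_trans _ hz).
    apply: le_trans (quotient_cmod (q2 z) c0 hc) _.
    rewrite ler_pdivrMr//; apply: le_trans (lerD (H z) (lexx _)) _.
    have k10 := cmod_ge0 (k 1).
    have := ler_wpM2l B0 (ltW hz); have := ler_wpM2l k10 (ltW hz).
    have := ler_wpM2l M0 (ltW (lt_trans (ltr0Sn _ 1) hz)); lra.
  - by rewrite !inE negb_or pnatr_eq0 -[1]/(1%:R) eqr_nat.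
exists (k 1 - q 2), (q 2) => s; rewrite q2 qc; ring.
Qed.

(** Multiplication by [s] repairs the puncture: s h(s) is continuous with value 0 at 0 and has
    linear growth, hence equals be * s. *)
Lemma liouville_punctured h M : (forall s, s != 0 -> cdiff h s) ->
  (forall s, s != 0 -> cmod (h s) <= M) -> forall s, s != 0 -> h s = h 1.
Proof.
move=> hd hM; have M0 : 0 <= M by apply: le_trans (hM 1 _); rewrite ?cmod_ge0 ?oner_eq0.
pose k s := s * h s.
have kM s : cmod (k s) <= M * cmod s.
  rewrite /k cmodM mulrC; have [->|s0] := eqVneq s 0; first by rewrite cmod0 !mulr0.
  by rewrite ler_wpM2r ?cmod_ge0 ?hM.
have kd s : s != 0 -> cdiff k s.
  by move=> s0; apply: cdiffM; [exact: cdiff_id|exact: hd].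
have kc s : ccont k s.
  have [->|s0] := eqVneq s 0; last exact/cdiff_cont/kd.
  move=> e e0; have M1 : 0 < M + 1 by rewrite ltr_wpDl.
  exists (e / (M + 1)); first by rewrite divr_gt0.
  move=> z; rewrite subr0 {2}/k mul0r subr0 ltr_pdivlMr// mulrC.
  apply: le_lt_trans; apply: le_trans (kM z) _.
  by rewrite ler_wpM2r ?cmod_ge0// lerDl.
have [|al [be H]] := linear_growth kc kd M0 (lexx 0); first by move=> s; rewrite addr0.
have al0 : al = 0 by have := H 0; rewrite /k mul0r mulr0 addr0.
have hs s : s != 0 -> h s = be.
  move=> s0; apply: (mulfI s0); have := H s; rewrite al0 add0r /k => ->.
  by rewrite mulrC.
by move=> s s0; rewrite !hs// oner_eq0.
Qed.

(** Replaces the passage r -> 1 in Schwarz estimates: if y < x, the midpoint of y / x and 1 is an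
    admissible [r] violating the hypothesis. *)
Lemma le_of_scaled (x y : R) : 0 <= y -> x <= 1 ->
  (forall r, y < r -> r < 1 -> r * x <= y) -> x <= y.
Proof.
move=> y0 x1 H; rewrite leNgt; apply/negP => yx.
have x0 : 0 < x by exact: le_lt_trans yx.
have yx1 : y / x < 1 by rewrite ltr_pdivrMr// mul1r.
have yyx : y <= y / x by rewrite ler_pdivlMr// ler_piMr.
have h1 : y < (1 + y / x) / 2 by lra.
have h2 : (1 + y / x) / 2 < 1 by lra.
have := H _ h1 h2; rewrite -ler_pdivlMr//; lra.
Qed.

Lemma schwarz k : (forall s, cmod s < 1 -> cdiff k s) -> k 0 = 0 ->
  (forall s, cmod s < 1 -> cmod (k s) <= 1) ->
  forall s, cmod s < 1 -> cmod (k s) <= cmod s.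
Proof.
move=> kd k0 kM s s1.
have k0d : cdiff k 0 by apply: kd; rewrite cmod0.
have [q [q1 q2 q3 q4]] := diff_quotient k0d.
have kq z : k z = q z * z by rewrite q2 k0 add0r subr0.
apply: le_of_scaled; [exact: cmod_ge0|exact: kM|move=> r sr r1].
have r0 : 0 < r by exact: le_lt_trans (cmod_ge0 s) sr.
suff H : cmod (q s) <= r^-1.
  by rewrite kq cmodM mulrA ler_piMl ?cmod_ge0// mulrC -ler_pdivlMr// div1r.
apply: (@max_modulus _ q [:: 0] r); rewrite ?ltW// => z.
- move=> hz; have [->//|z0] := eqVneq z 0; apply: q3 => //.
  exact/cdiff_cont/kd/(le_lt_trans hz).
- by rewrite inE => hz z0; apply: q4 => //; exact/kd/(lt_trans hz).
- move=> hz; have hz1 : cmod z < 1 by rewrite hz.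
  by have := kM z hz1; rewrite kq cmodM hz -ler_pdivlMr// div1r.
Qed.

(** Since k is merely continuous at 0, k / z need not be known to extend; but k = O(z) by
    [lipschitz_at0], so k^2 / z tends to 0. Its value at 0 is already 0 because 0^-1 = 0, and the
    maximum principle applies with 0 exceptional. *)
Lemma weak_schwarz k : (forall s, cmod s < 1 -> ccont k s) ->
  (forall s, cmod s < 1 -> s != 0 -> cdiff k s) -> k 0 = 0 ->
  (forall s, cmod s < 1 -> cmod (k s) <= 1) ->
  forall s, cmod s < 1 -> cmod (k s) ^+ 2 <= cmod s.
Proof.
move=> kc kd k0 kM s s1.
pose m z := k z ^+ 2 / z.
have h21 : 2^-1 < 1 :> R by rewrite invf_lt1// ltr1n.
(* The Lipschitz bound with r = 1/2 and M = 1; the square of its constant 8 is the 64 below. *)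
have lip a : a != 0 -> cmod a <= 4^-1 -> cmod (k a) <= 8 * cmod a.
  move=> a0 ha; have h20 : 0 < 2^-1 :> R by rewrite invr_gt0.
  have := @lipschitz_at0 k [:: 0] 2^-1 1 h20 ltr01 _ _ _ k0 a.
  rewrite inE a0 (_ : 4 * 1 / 2^-1 = 8 :> R); last by field.
  rewrite (_ : 2^-1 / 2 = 4^-1 :> R); last by field.
  apply=> // z hz; [exact/kc/(le_lt_trans hz)| |exact/kM/(le_lt_trans hz)].
  by rewrite inE => z0; apply: kd => //; exact: lt_trans hz h21.
have mc0 : ccont m 0.
  move=> e e0; exists (Num.min 4^-1 (e / 64)); first by rewrite lt_min invr_gt0 ltr0n divr_gt0.
  move=> z; rewrite subr0 lt_min => /andP[z4 ze].
  rewrite {2}/m invr0 mulr0 subr0 /m.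
  have [->|z0] := eqVneq z 0; first by rewrite invr0 mulr0 cmod0.
  have zz0 : 0 < cmod z by rewrite cmod_gt0.
  rewrite cmodM cmodV cmodX ltr_pdivrMr//.
  have := lip z z0 (ltW z4); rewrite -(ler_pXn2r (n:=2)) ?nnegrE ?mulr_ge0 ?cmod_ge0//.
  move=> /le_lt_trans; apply; rewrite exprMn expr2 [cmod z ^+ 2]expr2 mulrA ltr_pM2r//.
  by rewrite -natrM mulrC -ltr_pdivlMr.
have md z : cmod z < 1 -> z != 0 -> cdiff m z.
  move=> z1 z0; apply: cdiff_div => //; last exact: cdiff_id.
  by apply: (@cdiffM _ k k); exact: kd.
apply: le_of_scaled; [exact: cmod_ge0|by rewrite exprn_ile1 ?cmod_ge0 ?kM|move=> r sr r1].
have r0 : 0 < r by exact: le_lt_trans (cmod_ge0 s) sr.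
have [->|s0] := eqVneq s 0; first by rewrite k0 cmod0 expr0n mulr0.
have H : cmod (m s) <= r^-1.
  apply: (@max_modulus _ m [:: 0] r); rewrite ?ltW// => z.
  - move=> hz; have [->//|z0] := eqVneq z 0; exact/cdiff_cont/md/z0/(le_lt_trans hz).
  - by rewrite inE => hz z0; apply: md => //; exact: (lt_trans hz).
  - move=> hz; have hz1 : cmod z < 1 by rewrite hz.
    rewrite /m cmodM cmodV hz cmodX ler_piMl ?invr_ge0 ?(ltW r0)//.
    by rewrite exprn_ile1 ?cmod_ge0 ?kM.
move: H; rewrite /m cmodM cmodV cmodX ler_pdivrMr ?cmod_gt0//.
by rewrite mulrC ler_pdivlMr// mulrC.
Qed.

(** The weak Schwarz estimate for the Cayley transform reads |h s|^2 <= |s| (2A + |h s|)^2. As A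
    tends to 0 this forces h s = 0, because |s| < 1. *)
Lemma Re_ge0_eq0 h : (forall s, cmod s < 1 -> ccont h s) ->
  (forall s, cmod s < 1 -> s != 0 -> cdiff h s) -> h 0 = 0 ->
  (forall s, cmod s < 1 -> 0 <= complex.Re (h s)) ->
  forall s, cmod s < 1 -> h s = 0.
Proof.
move=> hc hd h0 hR s s1; apply/eqP; rewrite -cmod_eq0; apply: contraT => hs.
set x := cmod (h s) in hs; have x0 : 0 < x by rewrite lt_def hs cmod_ge0.
(* The Cayley transform h / (2A + h) maps into the unit disc for every A > 0. *)
have key (A : R) : 0 < A -> x ^+ 2 <= cmod s * (2 * A + x) ^+ 2.
  move=> A0; have A2 : 0 < 2 * A by rewrite mulr_gt0.
  pose D z := ((2 * A)%:C)%C + h z.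
  have Dge z : cmod z < 1 -> cmod (h z) <= cmod (D z) /\ D z != 0.
    move=> /hR hz; have hD : cmod (D z) ^+ 2 =
        (2 * A + complex.Re (h z)) ^+ 2 + complex.Im (h z) ^+ 2.
      by rewrite cmod_sqr /D; case: (h z) => a b /=; rewrite add0r.
    have hA : 0 < 2 * A + complex.Re (h z) by rewrite ltr_pwDl.
    split; last first.
      by rewrite -cmod_eq0 -sqrf_eq0 hD gt_eqF// ltr_pwDl ?sqr_ge0// exprn_gt0.
    rewrite -(ler_pXn2r (n:=2)) ?nnegrE ?cmod_ge0// hD cmod_sqr lerD2r.
    by rewrite ler_pXn2r ?nnegrE ?(ltW hA)// lerDr ltW.
  pose k z := h z / D z.
  have kc z : cmod z < 1 -> ccont k z.
    move=> z1; have [_ D0] := Dge z z1; apply: ccontM; first exact: hc.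
    by apply: ccontV => //; apply: ccontD; [exact: ccont_cst|exact: hc].
  have kd z : cmod z < 1 -> z != 0 -> cdiff k z.
    move=> z1 z0; have [_ D0] := Dge z z1; apply: cdiff_div => //; first exact: hd.
    by apply: cdiffD; [exact: cdiff_cst|exact: hd].
  have := @weak_schwarz k kc kd _ _ s s1.
  rewrite /k h0 mul0r => /(_ erefl)/(_ _)H.
  have [hD D0] := Dge s s1.
  have : cmod (h s / D s) ^+ 2 <= cmod s.
    apply: H => z z1; have [hz Dz] := Dge z z1.
    by rewrite cmodM cmodV ler_pdivrMr ?cmod_gt0// mul1r.
  rewrite cmodM cmodV expr_div_n ler_pdivrMr ?exprn_gt0 ?cmod_gt0//.
  move=> /le_trans; apply; rewrite ler_wpM2l ?cmod_ge0//.
  rewrite ler_pXn2r ?nnegrE ?cmod_ge0 ?addr_ge0 ?(ltW x0) ?(ltW A2)//.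
  by apply: le_trans (cmodD _ _) _; rewrite cmod_real gtr0_norm.
set t := cmod s in s1 key; have t0 : 0 <= t by exact: cmod_ge0.
(* An explicit small A, namely x (1 - t) / 16, replaces the limit: t (1 + (1 - t) / 8)^2 < 1 for 0
   <= t < 1. *)
have eta0 : 0 < (1 - t) / 16 by rewrite divr_gt0// subr_gt0.
have := key (x * ((1 - t) / 16)) (mulr_gt0 x0 eta0).
have -> : t * (2 * (x * ((1 - t) / 16)) + x) ^+ 2 = x ^+ 2 * (t * (1 + (1 - t) / 8) ^+ 2).
  by field.
rewrite -[leLHS]mulr1 ler_pM2l ?exprn_gt0// leNgt => /negP[].
have t1 : 0 < 1 - t by rewrite subr_gt0.
have := mulr_ge0 t0 (ltW t1).
nra.
Qed.

End OneVariable.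

(** * Automorphisms of the punctured plane *)

Section PuncturedPlane.
Variable R : realType.
Local Notation C := R[i].
Implicit Types (s z p a b w : C) (k h q S T : C -> C) (e d r M : R).

Definition left_inverse_off0 S T := forall s, s != 0 -> S s != 0 /\ T (S s) = s.

Lemma Re_segment p (q0 : C) (t : R) :
  complex.Re (p + (t%:C)%C * (q0 - p)) =
    (1 - t) * complex.Re p + t * complex.Re q0.
Proof. by case: p q0 => a b [c d'] /=; ring. Qed.

Lemma Im_segment p (q0 : C) (t : R) :
  complex.Im (p + (t%:C)%C * (q0 - p)) =
    (1 - t) * complex.Im p + t * complex.Im q0.
Proof. by case: p q0 => a b [c d'] /=; ring. Qed.

(** Otherwise |S| would take the value 1 on the segment, inside the forbidden range from e to
    1/e. *)
Lemma segment_avoid S (e dl : R) s1 s2 : 0 < e -> e < 1 ->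
  (forall s, s != 0 -> ccont S s) ->
  (forall s, s != 0 -> cmod s < dl -> cmod (S s) < e \/ e^-1 < cmod (S s)) ->
  cmod s1 < dl -> cmod s2 < dl ->
  (forall t : R, 0 <= t <= 1 -> s1 + (t%:C)%C * (s2 - s1) != 0) ->
  cmod (S s1) < e -> cmod (S s2) < e.
Proof.
move=> e0 e1 Sc Hd m1 m2 seg S1.
pose g t := s1 + (t%:C)%C * (s2 - s1).
have g1 : g 1 = s2 by rewrite /g mul1r subrKC.
have g0 : g 0 = s1 by rewrite /g mul0r addr0.
have gm t : 0 <= t <= 1 -> cmod (g t) < dl.
  move=> /andP[t0 t1]; have -> : g t = ((1 - t)%:C)%C * s1 + (t%:C)%C * s2.
    by rewrite /g rmorphB /=; ring.
  apply: le_lt_trans (cmodD _ _) _; rewrite !cmodM !cmod_real !ger0_norm ?subr_ge0//.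
  have [->|t0'] := eqVneq t 0; first by rewrite subr0 mul1r mul0r addr0.
  have tp : 0 < t by rewrite lt_def t0'.
  have h2 : t * cmod s2 < t * dl by rewrite ltr_pM2l.
  have h1 : (1 - t) * cmod s1 <= (1 - t) * dl by rewrite ler_wpM2l ?subr_ge0// ltW.
  lra.
have n2 : s2 != 0 by rewrite -g1; apply: seg; rewrite ler01 lexx.
have [//|S2] := Hd s2 n2 m2.
have ei1 : 1 < e^-1 by rewrite invf_gt1.
have [] := @IVT R (fun t => cmod (S (g t))) 0 1 1 ler01.
- apply: cont_within => t ht eta eta0.
  have [d d0 hd] := rcont_cmod (Sc _ (seg t ht)) eta0.
  have M0 : 0 < cmod (s2 - s1) + 1 by rewrite ltr_wpDl ?cmod_ge0.
  exists (d / (cmod (s2 - s1) + 1)); first by rewrite divr_gt0.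
  move=> y; rewrite ltr_pdivlMr// => hy; apply: hd.
  have -> : g y - (s1 + (t%:C)%C * (s2 - s1)) = ((y - t)%:C)%C * (s2 - s1).
    by rewrite /g rmorphB /=; ring.
  rewrite cmodM cmod_real; apply: le_lt_trans hy.
  by rewrite ler_wpM2l// lerDl.
- rewrite g0 g1 ge_min le_max (ltW (lt_trans S1 e1)) /=.
  by rewrite (ltW (lt_trans ei1 S2)) orbT.
move=> t; rewrite in_itv /= => ht St.
have [] := Hd _ (seg t ht) (gm t ht); rewrite -/(g t) St; lra.
Qed.

(** The punctured disc is joined to dl / 2 by at most two segments missing 0: one suffices off the
    negative real axis, and points of that axis are reached through i dl / 2. *)
Lemma small_near0 S (e dl : R) : 0 < e -> e < 1 -> 0 < dl ->
  (forall s, s != 0 -> ccont S s) ->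
  (forall s, s != 0 -> cmod s < dl -> cmod (S s) < e \/ e^-1 < cmod (S s)) ->
  cmod (S ((dl / 2)%:C)%C) < e ->
  forall s, s != 0 -> cmod s < dl -> cmod (S s) < e.
Proof.
move=> e0 e1 dl0 Sc Hd S1; pose rho := dl / 2.
have rho0 : 0 < rho by rewrite divr_gt0.
have rhod : rho < dl by rewrite ltr_pdivrMr// ltr_pMr// ltr1n.
pose p1 : C := (rho%:C)%C; pose p2 : C := (0 +i* rho)%C.
have mp1 : cmod p1 < dl by rewrite cmod_real gtr0_norm.
have mp2 : cmod p2 < dl.
  by rewrite /cmod /= expr0n add0r sqrtr_sqr gtr0_norm.
have np1 : p1 != 0 by rewrite -cmod_gt0 cmod_real gtr0_norm.
have sg := @segment_avoid S e dl _ _ e0 e1 Sc Hd.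
have segn z1 z2 (t : R) : z1 + (t%:C)%C * (z2 - z1) = 0 ->
    (1 - t) * complex.Re z1 + t * complex.Re z2 = 0 /\
    (1 - t) * complex.Im z1 + t * complex.Im z2 = 0.
  by move=> H; rewrite -Re_segment -Im_segment H.
have direct s : s != 0 -> cmod s < dl ->
    ~~ ((complex.Im s == 0) && (complex.Re s <= 0)) -> cmod (S s) < e.
  move=> s0 sd si; apply: (sg p1) => // t /andP[t0 t1].
  apply/eqP => /segn[/= h1 h2]; rewrite mulr0 add0r in h2.
  move/eqP: h2; rewrite mulf_eq0 => /orP[/eqP t0'|si0].
    by move: h1; rewrite t0' subr0 mul1r mul0r addr0 => h; rewrite h ltxx in rho0.
  move: si; rewrite si0 /= -ltNge => a0.
  move: t1; rewrite le_eqVlt => /orP[/eqP t1'|t1].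
    by move: h1; rewrite t1' subrr mul0r add0r mul1r => h; rewrite h ltxx in a0.
  have := mulr_ge0 t0 (ltW a0).
  have : 0 < (1 - t) * rho by rewrite mulr_gt0// subr_gt0.
  lra.
move=> s s0 sd; have [/andP[/eqP b0 a0]|] :=
  boolP ((complex.Im s == 0) && (complex.Re s <= 0)); last exact: direct.
apply: (sg p2) => //; last first.
  apply: direct => //=; last by rewrite gt_eqF.
  by apply/eqP => -[/eqP]; rewrite gt_eqF.
move=> t /andP[t0 t1]; apply/eqP => /segn[/= h1 h2].
move/eqP: h2; rewrite b0 mulr0 addr0 mulf_eq0 (gt_eqF rho0) orbF subr_eq0.
move=> /eqP t1'; move: h1; rewrite -t1' mulr0 add0r mul1r => h1.
by move: s0; rewrite eq_complex /= h1 b0 eqxx.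
Qed.

(** The forbidden range is symmetric under inversion, so [small_near0] applies either to S or to 1 /
    S, depending on the value at dl / 2. *)
Lemma puncture_connected S (e dl : R) : 0 < e -> e < 1 -> 0 < dl ->
  (forall s, s != 0 -> S s != 0) -> (forall s, s != 0 -> ccont S s) ->
  (forall s, s != 0 -> cmod s < dl -> cmod (S s) < e \/ e^-1 < cmod (S s)) ->
  (forall s, s != 0 -> cmod s < dl -> cmod (S s) < e) \/
  (forall s, s != 0 -> cmod s < dl -> cmod (S s)^-1 < e).
Proof.
move=> e0 e1 dl0 S0 Sc Hd.
have p0 : ((dl / 2)%:C)%C != 0 :> C.
  by rewrite -cmod_gt0 cmod_real gtr0_norm ?divr_gt0.
have pd : cmod (((dl / 2)%:C)%C : C) < dl.
  by rewrite cmod_real gtr0_norm ?divr_gt0// ltr_pdivrMr// ltr_pMr// ltr1n.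
have inv s : s != 0 -> e^-1 < cmod (S s) -> cmod (S s)^-1 < e.
  by move=> s0 h; rewrite cmodV invf_plt ?posrE ?cmod_gt0 ?S0.
have [h|h] := Hd _ p0 pd; first by left; exact: (small_near0 e0 e1 dl0 Sc Hd h).
right; apply: (small_near0 e0 e1 dl0 _ _ (inv _ p0 h)).
  by move=> s s0; apply: ccontV; [exact: S0|exact: Sc].
move=> s s0 sd; case: (Hd s s0 sd) => [h'|h']; [right|left; exact: inv].
by rewrite cmodV ltf_pV2 ?posrE ?cmod_gt0 ?S0.
Qed.

(** On the annulus e <= |z| <= 1/e the modulus of T has a positive minimum; for |s| below it, S s
    cannot lie in the annulus because T (S s) = s. That the same alternative holds for every e is
    seen by comparison with e = 1/2 at a common point. *)
Lemma zero_or_pole S T : (forall s, s != 0 -> ccont S s) ->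
  (forall s, s != 0 -> ccont T s) -> left_inverse_off0 S T -> left_inverse_off0 T S ->
  (forall e, 0 < e -> exists2 d : R, 0 < d &
     forall s, s != 0 -> cmod s < d -> cmod (S s) < e) \/
  (forall e, 0 < e -> exists2 d : R, 0 < d &
     forall s, s != 0 -> cmod s < d -> cmod (S s)^-1 < e).
Proof.
move=> Sc Tc ST TS.
have dich e : 0 < e -> e < 1 -> exists2 d : R, 0 < d &
  (forall s, s != 0 -> cmod s < d -> cmod (S s) < e) \/
  (forall s, s != 0 -> cmod s < d -> cmod (S s)^-1 < e).
  move=> e0 e1; have ei1 : 1 < e^-1 by rewrite invf_gt1.
  have ne s : e <= cmod s <= e^-1 -> s != 0.
    by move=> /andP[h _]; rewrite -cmod_gt0 (lt_le_trans e0).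
  have [p hp hmax] := @annulus_max _ (fun s => - cmod (T s)) e e^-1 (ltW e0)
    (ltW (lt_trans e1 ei1)) (fun z hz eta eta0 => ltac:(
      have [d d0 hd] := rcont_cmod (Tc z (ne z hz)) eta0;
      exists d => // s /hd; rewrite -opprD normrN; apply)).
  have Tp : 0 < cmod (T p) by rewrite cmod_gt0; case: (TS p (ne p hp)).
  exists (cmod (T p)) => //; apply: puncture_connected => //.
    by move=> s /ST[].
  move=> s s0 hs; have [S0 TSs] := ST s s0.
  case: (ltP (cmod (S s)) e) => [h|h]; first by left.
  case: (ltP e^-1 (cmod (S s))) => [h'|h']; first by right.
  have := hmax (S s); rewrite h h' TSs lerN2 leNgt hs => /(_ isT); discriminate.
have h21 : 2^-1 < 1 :> R by rewrite invf_lt1// ltr1n.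
have h20 : 0 < 2^-1 :> R by rewrite invr_gt0.
have [d0 d00 hd0] := dich _ h20 h21.
have common d : 0 < d -> exists s : C, [/\ s != 0, cmod s < d & cmod s < d0].
  move=> dp; pose m := Num.min d d0 / 2.
  have m0 : 0 < Num.min d d0 by rewrite lt_min dp.
  exists ((m%:C)%C : C); rewrite -cmod_gt0 cmod_real gtr0_norm ?divr_gt0//.
  have hm : m < Num.min d d0 by rewrite ltr_pdivrMr// ltr_pMr// ltr1n.
  by move: hm; rewrite lt_min => /andP[].
have excl s : s != 0 -> cmod (S s) < 1 -> cmod (S s)^-1 < 1 -> False.
  move=> /ST[S0 _] h; rewrite cmodV invf_lt1 ?cmod_gt0//.
  by move=> h'; have := lt_trans h h'; rewrite ltxx.
have small e : 0 < e -> exists e', [/\ 0 < e', e' < 1 & e' <= e].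
  move=> ep; exists (Num.min e 2^-1); rewrite lt_min ep h20 ge_min lexx; split=> //.
  by rewrite gt_min h21 orbT.
case: hd0 => hd0; [left|right] => e /small[e' [e'0 e'1 e'e]];
  have [d dp [hd|hd]] := dich e' e'0 e'1.
- by exists d => // s s0 /(hd s s0) h; exact: lt_le_trans e'e.
- have [s [s0 sd sd0]] := common d dp; case: (excl s s0).
    exact: lt_trans (hd0 s s0 sd0) h21.
  exact: lt_trans (hd s s0 sd) e'1.
- have [s [s0 sd sd0]] := common d dp; case: (excl s s0).
    exact: lt_trans (hd s s0 sd) e'1.
  exact: lt_trans (hd0 s s0 sd0) h21.
- by exists d => // s s0 /(hd s s0) h; exact: lt_le_trans e'e.
Qed.

(** Inversion turns the behaviour of T at infinity into that of [t] at 0. Once [t] tends to 0, its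
    Lipschitz bound there says that S grows at most linearly. *)
Lemma zero_at0_linear S T : (forall s, s != 0 -> cdiff S s) ->
  (forall s, s != 0 -> cdiff T s) -> left_inverse_off0 S T -> left_inverse_off0 T S ->
  (forall e, 0 < e -> exists2 d : R, 0 < d &
     forall s, s != 0 -> cmod s < d -> cmod (S s) < e) ->
  exists2 c, c != 0 & forall s, s != 0 -> S s = c * s.
Proof.
move=> Sd Td ST TS Slim.
have invp S' T' : left_inverse_off0 S' T' ->
    left_inverse_off0 (fun s => (S' s^-1)^-1) (fun s => (T' s^-1)^-1).
  move=> H s s0; have si0 : s^-1 != 0 by rewrite invr_eq0.
  by have [h1 h2] := H _ si0; rewrite invr_eq0 h1 invrK h2 invrK.
have invd k : (forall s, s != 0 -> cdiff k s) -> (forall s, s != 0 -> k s != 0) ->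
    forall s, s != 0 -> cdiff (fun s => (k s^-1)^-1) s.
  move=> kd k0 s s0; have si0 : s^-1 != 0 by rewrite invr_eq0.
  apply: (@cdiffV _ (fun s => k s^-1)); first exact: k0.
  apply: (@cdiff_comp _ k); last exact: kd.
  by apply: (@cdiffV _ id) => //; exact: cdiff_id.
have S0 s : s != 0 -> S s != 0 by move=> /ST[].
have T0 s : s != 0 -> T s != 0 by move=> /TS[].
pose t s := (T s^-1)^-1.
have td := invd T Td T0; have sd := invd S Sd S0.
have [tl|tl] := zero_or_pole (fun s hs => cdiff_cont (td s hs))
  (fun s hs => cdiff_cont (sd s hs)) (invp _ _ TS) (invp _ _ ST); last first.
(* otherwise T tends to 0 at infinity, although S o T is the identity *)
  have [d d0 hd] := Slim 1 ltr01; have [d' d'0 hd'] := tl d d0.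
  pose m := Num.min (d' / 2) 1.
  have m0 : 0 < m by rewrite lt_min ltr01 andbT divr_gt0.
  have md : m < d' by rewrite gt_min ltr_pdivrMr// ltr_pMr// ltr1n.
  have mc0 : ((m%:C)%C : C) != 0 by rewrite -cmod_gt0 cmod_real gtr0_norm.
  have mi0 : ((m%:C)%C : C)^-1 != 0 by rewrite invr_eq0.
  have := hd' _ mc0; rewrite cmod_real gtr0_norm// invrK => /(_ md) h.
  have := hd _ (T0 _ mi0) h; have [_ ->] := TS _ mi0.
  by rewrite cmodV cmod_real gtr0_norm// invf_lt1// ltNge ge_min lexx orbT.
pose t0 s := if s == 0 then 0 else t s.
have near_ne (k1 k2 : C -> C) s : s != 0 -> (forall z, z != 0 -> k1 z = k2 z) ->
    forall z, cmod (z - s) < cmod s -> k1 z = k2 z.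
  move=> s0 H z hz; apply: H; apply: contraTneq hz => ->.
  by rewrite sub0r cmodN ltxx.
have t0d s : s != 0 -> cdiff t0 s.
  move=> s0; apply: (@cdiff_near _ t _ s (cmod s)); rewrite ?cmod_gt0//.
    by apply: near_ne => // z z0; rewrite /t0 (negbTE z0).
  exact: td.
have ext0 (k : C -> C) : k 0 = 0 -> (forall e, 0 < e -> exists2 d : R, 0 < d &
     forall s, s != 0 -> cmod s < d -> cmod (k s) < e) -> ccont k 0.
  move=> k0 H e e0; have [d d0 hd] := H e e0; exists d => // s; rewrite !subr0 k0 subr0.
  by have [->|s0] := eqVneq s 0; [rewrite k0 cmod0|exact: hd].
have t0c : ccont t0 0.
  apply: ext0; first by rewrite /t0 eqxx.
  move=> e /tl[d d0 hd]; exists d => // s s0; rewrite /t0 (negbTE s0); exact: hd.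
have [r r0 hr] : exists2 r, 0 < r & forall s, cmod s <= r -> cmod (t0 s) <= 1.
  have [d d0 hd] := t0c 1 ltr01; exists (d / 2); first by rewrite divr_gt0.
  move=> s hs; have := hd s; rewrite subr0 {2}/t0 eqxx subr0 => h; apply/ltW/h.
  by rewrite (le_lt_trans hs)// ltr_pdivrMr// ltr_pMr// ltr1n.
have lip := @lipschitz_at0 _ t0 [:: 0] r 1 r0 ltr01.
have {}lip s : s != 0 -> cmod s <= r / 2 -> cmod (t s) <= 4 * 1 / r * cmod s.
  move=> s0 hs; have := lip _ _ hr _ s; rewrite inE /t0 eqxx (negbTE s0) -/t0; apply => //.
    by move=> z _; have [->//|z0] := eqVneq z 0; exact/cdiff_cont/t0d.
  by move=> z _; rewrite inE; exact: t0d.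
pose K := 4 * 1 / r; have K0 : 0 < K by rewrite divr_gt0// mulr1.
(* At (S s)^-1 the function [t] takes the value s^-1, so the Lipschitz bound reads 1/|s| <= K/|S s|.
   It is available when |S s| > 2/r. *)
have grow s : s != 0 -> cmod (S s) <= K * cmod s + 2 / r.
  move=> s0; have [Ss TSs] := ST s s0.
  have c0 : 0 < cmod (S s) by rewrite cmod_gt0.
  have [h|h] := leP (cmod (S s)) (2 / r).
    by apply: le_trans h _; rewrite lerDr mulr_ge0 ?cmod_ge0// ltW.
  have : cmod (t (S s)^-1) <= K * cmod (S s)^-1.
    apply: lip; rewrite ?invr_eq0// cmodV -[r / 2]invrK invf_div.
    by rewrite lef_pV2 ?posrE ?divr_gt0// ltW.
  rewrite /t invrK TSs !cmodV ler_pdivlMr// mulrC ler_pdivrMr ?cmod_gt0// => h'.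
  by apply: (le_trans h'); rewrite lerDl divr_ge0// ltW.
pose S' s := if s == 0 then 0 else S s.
have S'd s : s != 0 -> cdiff S' s.
  move=> s0; apply: (@cdiff_near _ S _ s (cmod s)); rewrite ?cmod_gt0//.
    by apply: near_ne => // z z0; rewrite /S' (negbTE z0).
  exact: Sd.
have S'c s : ccont S' s.
  have [->|s0] := eqVneq s 0; last exact/cdiff_cont/S'd.
  apply: ext0; first by rewrite /S' eqxx.
  move=> e /Slim[d d0 hd]; exists d => // z z0; rewrite /S' (negbTE z0); exact: hd.
have r20 : 0 <= 2 / r by rewrite divr_ge0// ltW.
have [|al [be H]] := linear_growth S'c S'd (ltW K0) r20.
  move=> s; rewrite /S'; case: eqVneq => [->|/grow//].
  by rewrite !cmod0 mulr0 add0r.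
have al0 : al = 0 by have := H 0; rewrite /S' eqxx mulr0 addr0.
have Sbe s : s != 0 -> S s = be * s.
  by move=> s0; have := H s; rewrite /S' (negbTE s0) al0 add0r.
exists be => //; have := S0 1 (oner_neq0 _); rewrite Sbe ?oner_neq0//.
by rewrite mulr1.
Qed.

(** In the pole case 1 / S has the limit 0, and its inverse is s -> T (1/s). *)
Lemma punctured_plane_aut S T : (forall s, s != 0 -> cdiff S s) ->
  (forall s, s != 0 -> cdiff T s) -> left_inverse_off0 S T -> left_inverse_off0 T S ->
  exists2 c, c != 0 & (forall s, s != 0 -> S s = c * s) \/
                      (forall s, s != 0 -> S s = c * s^-1).
Proof.
move=> Sd Td ST TS.
have [h|h] := zero_or_pole (fun s hs => cdiff_cont (Sd s hs))
  (fun s hs => cdiff_cont (Td s hs)) ST TS.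
  by have [c c0 hc] := zero_at0_linear Sd Td ST TS h; exists c => //; left.
have [||||c c0 hc] := @zero_at0_linear (fun s => (S s)^-1) (fun s => T s^-1) _ _ _ _ h.
- by move=> s s0; apply: cdiffV; [case: (ST s s0)|exact: Sd].
- move=> s s0; apply: (@cdiff_comp _ T); last by apply: Td; rewrite invr_eq0.
  by apply: (@cdiffV _ id) => //; exact: cdiff_id.
- by move=> s s0; have [h1 h2] := ST s s0; rewrite invr_eq0 invrK.
- move=> s s0; have si0 : s^-1 != 0 by rewrite invr_eq0.
  by have [h1 h2] := TS _ si0; rewrite h2 invrK.
exists c^-1; first by rewrite invr_eq0.
by right=> s s0; rewrite -invfM -hc// invrK.
Qed.

End PuncturedPlane.

(** * The Lorentz form and the negative cone *)

Section LorentzForm.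
Variables (R : realType) (n : nat).
Local Notation C := R[i].
Local Notation vec := ('I_n.+1 -> C).
Implicit Types (x y z u v p d : vec) (a b s : C) (A M : 'M[C]_n.+1).

Definition eta (j : 'I_n.+1) : C := if j == ord0 then -1 else 1.
Definition herm x y : C := \sum_j eta j * x j * (y j)^*%C.
Definition app A x : vec := fun i => \sum_j A i j * x j.
Definition e0 : vec := fun i => (i == ord0)%:R.
Definition line p d s : vec := fun i => p i + s * d i.
(** Used with a = 1 for the section of the cone over the ball, and with a = 0 for directions tangent
    to that section. *)
Definition ext a (w : 'I_n -> C) : vec := fun i => oapp w a (unlift ord0 i).
Definition hform z : R := - cmod (z ord0) ^+ 2 + \sum_(i < n) cmod (z (lift ord0 i)) ^+ 2.

Lemma ext0 a w : ext a w ord0 = a.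
Proof. by rewrite /ext unlift_none. Qed.
Lemma ext_lift a w k : ext a w (lift ord0 k) = w k.
Proof. by rewrite /ext liftK. Qed.
Lemma conjN1 : ((-1 : C)^*)%C = -1.
Proof. exact: rmorphN1. Qed.

Lemma eta_conj j : (eta j)^*%C = eta j.
Proof. by rewrite /eta; case: ifP; rewrite ?conjN1 ?conjc1. Qed.

Lemma hermD a b x y z : herm (fun i => a * x i + b * y i) z = a * herm x z + b * herm y z.
Proof. by rewrite /herm !mulr_sumr -big_split; apply: eq_bigr => i _ /=; ring. Qed.

Lemma hermC x y : herm y x = (herm x y)^*%C.
Proof.
rewrite /herm rmorph_sum; apply: eq_bigr => i _ /=.
by rewrite !rmorphM /= eta_conj conjcK; ring.
Qed.

Lemma hermDr a b x y z : herm z (fun i => a * x i + b * y i) =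
  a^*%C * herm z x + b^*%C * herm z y.
Proof. by rewrite hermC hermD rmorphD !rmorphM /= -!hermC. Qed.

Lemma hermxx z : herm z z = ((hform z)%:C)%C.
Proof.
rewrite /herm big_ord_recl /eta eqxx /hform rmorphD rmorphN rmorph_sum /=.
rewrite -mulrA mul_conjc mulN1r; congr (_ + _); apply: eq_bigr => i _.
by rewrite mul1r mul_conjc.
Qed.

Lemma app_lin A a b x y :
  app A (fun i => a * x i + b * y i) = fun i => a * app A x i + b * app A y i.
Proof.
apply/funext => i; rewrite /app !mulr_sumr -big_split; apply: eq_bigr => j _ /=; ring.
Qed.

Lemma app_scale A a x : app A (fun i => a * x i) = fun i => a * app A x i.
Proof. by apply/funext => i; rewrite /app mulr_sumr; apply: eq_bigr => j _; ring. Qed.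

Lemma app_line A p d s : app A (line p d s) = line (app A p) (app A d) s.
Proof.
by apply/funext => i; rewrite /app /line mulr_sumr -big_split; apply: eq_bigr => j _ /=; ring.
Qed.

Lemma app_mul A M x : app (A *m M) x = app A (app M x).
Proof.
apply/funext => i; rewrite /app.
under eq_bigr do rewrite mxE mulr_suml.
rewrite exchange_big; apply: eq_bigr => j _ /=; rewrite mulr_sumr.
by apply: eq_bigr => k _; ring.
Qed.

Lemma app_delta A k : app A (fun i => (i == k)%:R) = fun i => A i k.
Proof.
apply/funext => i; rewrite /app (bigD1 k)//= eqxx mulr1 big1 ?addr0// => j /negbTE->.
by rewrite mulr0.
Qed.

Lemma herm_delta j k :
  herm (fun i => (i == j)%:R) (fun i => (i == k)%:R) = if k == j then eta k else 0.
Proof.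
rewrite /herm (bigD1 k)//= eqxx conjc1 mulr1 big1 => [|i /negbTE->]; last first.
  by rewrite conjc0 mulr0.
by rewrite addr0; case: eqVneq; rewrite ?mulr1 ?mulr0.
Qed.

Lemma in_Un1P A : (forall x y, herm (app A x) (app A y) = herm x y) -> in_Un1 A.
Proof.
move=> H; apply/matrixP => i j; rewrite -mulmxA !mxE.
rewrite (_ : \sum_k _ = herm (app A (fun l => (l == j)%:R)) (app A (fun l => (l == i)%:R))).
  by rewrite H herm_delta /eta.
rewrite !app_delta /herm; apply: eq_bigr => k _; rewrite !mxE.
rewrite (bigD1 k)//= big1 => [|l]; last first.
  by rewrite !mxE eq_sym => /negbTE->; rewrite mul0r.
rewrite !mxE eqxx addr0 /eta; ring.
Qed.

(* Polarization: the form is sesquilinear over the complex numbers. *)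
Lemma isometry_polarization A : (forall x, herm (app A x) (app A x) = herm x x) ->
  forall x y, herm (app A x) (app A y) = herm x y.
Proof.
move=> H x y; have pol b := H (fun i => 1 * x i + b * y i).
have := pol 1; have := pol 'i%C; rewrite !app_lin !hermD !hermDr !H.
set X := herm x x; set Y := herm y y; set P := herm (app A x) (app A y).
set Q := herm (app A y) (app A x); set P' := herm x y; set Q' := herm y x.
have i2 := sqr_i R; have ci : ('i : C)%C^*%C = - 'i%C.
  by apply/eqP; rewrite eq_complex /= oppr0 !eqxx.
rewrite !conjc1 ci; set j := 'i%C in i2 * => h2 h1.
have E1 : P - P' = - (Q - Q').
  apply/eqP; rewrite -subr_eq0; apply/eqP.
  transitivity ((1 * (1 * X + 1 * P) + 1 * (1 * Q + 1 * Y)) -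
    (1 * (1 * X + 1 * P') + 1 * (1 * Q' + 1 * Y))); first by ring.
  by rewrite h1 subrr.
have E2 : j * (P - P') = j * (Q - Q').
  apply/eqP; rewrite -subr_eq0; apply/eqP.
  transitivity (- ((1 * (1 * X + - j * P) + j * (1 * Q + - j * Y)) -
    (1 * (1 * X + - j * P') + j * (1 * Q' + - j * Y)))); first by ring.
  by rewrite h2 subrr oppr0.
have j0 : j != 0 by apply: contra_eqN i2 => /eqP->; rewrite expr0n eq_sym oppr_eq0 oner_eq0.
have := mulfI j0 E2; rewrite E1 => E3.
have Q0 : Q - Q' = 0.
  have : (Q - Q') *+ 2 = 0 by rewrite mulr2n -{1}E3 addNr.
  by move/eqP; rewrite mulrn_eq0 /= => /eqP.
by apply/eqP; rewrite -subr_eq0 E1 Q0 oppr0.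
Qed.

(* The vector v is normalised, v_0 > 0, and M is minus the reflection in u = v + e0. *)
Lemma reflection_to_e0 V : hform V < 0 -> exists M,
  [/\ forall x y, herm (app M x) (app M y) = herm x y,
      forall x, app M (app M x) = x &
      forall k, app M V (lift ord0 k) = 0].
Proof.
move=> hV; have V0 : V ord0 != 0.
  apply: contraTneq hV; rewrite /hform => ->; rewrite cmod0 expr0n oppr0 add0r -leNgt.
  by rewrite sumr_ge0// => i _; rewrite sqr_ge0.
have m0 : 0 < cmod (V ord0) by rewrite cmod_gt0.
pose sg := Num.sqrt (- hform V).
have sg0 : 0 < sg by rewrite sqrtr_gt0 oppr_gt0.
have sg2 : sg ^+ 2 = - hform V by rewrite sqr_sqrtr// ltW// oppr_gt0.
pose al := cmod (V ord0) / sg.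
have al0 : 0 < al by rewrite divr_gt0.
pose ka : C := (V ord0)^*%C / ((cmod (V ord0) * sg)%:C)%C.
have msC : ((cmod (V ord0) * sg)%:C)%C != 0 :> C.
  by rewrite -cmod_gt0 cmod_real gtr0_norm mulr_gt0.
have ka0 : ka != 0 by rewrite mulf_neq0 ?invr_eq0// conjc_eq0.
(* The zero term gives [v] the shape to which [hermD] and [hermDr] apply. *)
pose v : vec := fun i => ka * V i + 0 * V i.
have vE : herm v v = -1.
  rewrite /v hermD hermDr hermxx conjc0 !mul0r !addr0 mulrA mul_conjc.
  have -> : cmod ka = sg^-1.
    rewrite /ka cmodM cmodV cmodC cmod_real gtr0_norm ?mulr_gt0//; field.
    by rewrite !gt_eqF.
  rewrite -rmorphM /= exprVn sg2 -(rmorphN1 (real_complex R)); congr (_ _).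
  by field; rewrite lt_eqF.
have v0 : v ord0 = (al%:C)%C.
  rewrite /v mul0r addr0 /ka mulrAC [_ * V _]mulrC mul_conjc -fmorphV -rmorphM /=.
  by congr (_ _); rewrite /al; field; rewrite !gt_eqF.
have VE : V = fun i => ka^-1 * v i.
  by apply/funext => i; rewrite /v mul0r addr0 mulKf.
clearbody v.
pose u : vec := fun i => 1 * v i + 1 * e0 i.
have ve : herm v e0 = - (al%:C)%C.
  rewrite /herm (bigD1 ord0)//= big1 => [|i /negbTE i0]; last first.
    by rewrite /e0 i0 conjc0 mulr0.
  by rewrite oppr0 addr0 v0 /eta eqxx -[(1 +i* 0)%C]/(1 : C); ring.
have ee : herm e0 e0 = -1 by rewrite herm_delta /eta !eqxx.
have ev : herm e0 v = - (al%:C)%C by rewrite hermC ve rmorphN; congr (- _); exact: conjc_real.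
have uu : herm u u = - 2 * (1 + (al%:C)%C).
  by rewrite /u hermD !hermDr conjc1 vE ve ev ee; ring.
have vu : herm v u = - (1 + (al%:C)%C) by rewrite /u hermDr conjc1 vE ve; ring.
have ul k : u (lift ord0 k) = v (lift ord0 k).
  by rewrite /u /e0 (_ : lift ord0 k == ord0 = false)// mulr0 addr0 mul1r.
clearbody u.
(* Here the normalisation v_0 > 0 pays off: herm u u = -2 (1 + al) cannot vanish, so the reflection
   exists. *)
have al1 : 1 + (al%:C)%C != 0 :> C.
  by rewrite -(rmorph1 (real_complex R)) -rmorphD /= -cmod_gt0 cmod_real gtr0_norm ?addr_gt0.
have N0 : herm u u != 0 by rewrite uu mulf_neq0// oppr_eq0 pnatr_eq0.
pose M : 'M[C]_n.+1 := \matrix_(i, j)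
  (- (i == j)%:R + 2 * eta j * (u j)^*%C / herm u u * u i).
have appM x : app M x = fun i => (-1) * x i + (2 * herm x u / herm u u) * u i.
  apply/funext => i; rewrite /app.
  under eq_bigr do rewrite mxE mulrDl.
  rewrite big_split /= (bigD1 i)//= eqxx big1 => [|j]; last first.
    by rewrite eq_sym => /negbTE->; rewrite oppr0 mul0r.
  rewrite addr0; congr (_ + _); rewrite /herm mulr_sumr !mulr_suml.
  by apply: eq_bigr => j _; ring.
have cuu : (herm u u)^*%C = herm u u by rewrite -hermC.
exists M; split.
- move=> x y; have cc : (2 * herm y u / herm u u)^*%C = 2 * herm u y / herm u u.
    transitivity (2^*%C * (herm y u)^*%C * ((herm u u)^-1)^*%C); first by rewrite -!rmorphM.
    by rewrite -hermC conjc_inv cuu conjc_nat.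
  by rewrite !appM hermD !hermDr cc conjN1; field.
- move=> x; rewrite appM [in herm _ _]appM hermD appM; apply/funext => i /=.
  by field.
- move=> k; rewrite VE app_scale appM vu uu ul.
  (* Hence M v = -v + u = e0, and M V is a multiple of e0. *)
  rewrite (_ : 2 * _ / _ = 1); last by field; rewrite al1.
  by ring.
Qed.

End LorentzForm.

(** * Affine coordinates on the cone and restriction to complex lines *)

Section NegativeCone.
Variables (R : realType) (n : nat).
Local Notation C := R[i].
Local Notation vec := ('I_n.+1 -> C).
Implicit Types (x y z u v p d : vec) (a b s : C) (A M : 'M[C]_n.+1) (F G : vec -> vec)
  (w : 'I_n -> C).

Definition nsq m (w : 'I_m -> C) : R := \sum_k cmod (w k) ^+ 2.
Definition scale s z : vec := fun i => s * z i.
Definition aff z : 'I_n -> C := fun k => z (lift ord0 k) / z ord0.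

Lemma nsq_ge0 m (w : 'I_m -> C) : 0 <= nsq w.
Proof. by apply: sumr_ge0 => i _; exact: sqr_ge0. Qed.

Lemma nsq_scale m s (w : 'I_m -> C) : nsq (fun k => s * w k) = cmod s ^+ 2 * nsq w.
Proof. by rewrite /nsq mulr_sumr; apply: eq_bigr => k _; rewrite cmodM exprMn. Qed.

Lemma hform_scale s z : hform (scale s z) = cmod s ^+ 2 * hform z.
Proof.
rewrite /hform /scale mulrDr mulrN mulr_sumr cmodM exprMn; congr (_ + _).
by apply: eq_bigr => k _; rewrite cmodM exprMn.
Qed.

Lemma Cn1_neq0 z : Cn1 z -> z ord0 != 0.
Proof.
apply: contraPneq => z0; rewrite /Cn1 z0 cmod0 expr0n oppr0 add0r.
by apply/negP; rewrite -leNgt; exact: nsq_ge0.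
Qed.

Lemma Cn1_scale s z : s != 0 -> Cn1 z -> Cn1 (scale s z).
Proof.
move=> s0; rewrite /Cn1 -!/(hform _) hform_scale => hz.
by rewrite pmulr_rlt0// exprn_gt0// cmod_gt0.
Qed.

Lemma Cn1_aff z : Cn1 z <-> z ord0 != 0 /\ nsq (aff z) < 1.
Proof.
suff H : z ord0 != 0 -> Cn1 z <-> nsq (aff z) < 1.
  by split=> [hz|[z0 /H]]; [split; [exact: Cn1_neq0|exact/H/hz/Cn1_neq0]|exact].
move=> z0; have -> : nsq (aff z) = nsq (fun k => z (lift ord0 k)) / cmod (z ord0) ^+ 2.
  rewrite mulrC -exprVn -cmodV -nsq_scale; congr nsq; apply/funext => k.
  by rewrite mulrC.
rewrite ltr_pdivrMr ?exprn_gt0 ?cmod_gt0// mul1r /Cn1 addrC subr_lt0.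
by [].
Qed.

Lemma aff_ext a w : aff (ext a w) = fun k => w k / a.
Proof. by apply/funext => k; rewrite /aff ext_lift ext0. Qed.

Lemma Cn1_ext w : nsq w < 1 -> Cn1 (ext 1 w).
Proof.
move=> h; apply/Cn1_aff; rewrite ext0 oner_neq0 aff_ext; split=> //.
by rewrite (_ : (fun k => _) = w)//; apply/funext => k; rewrite divr1.
Qed.

Lemma scale_aff z : z ord0 != 0 -> z = scale (z ord0) (ext 1 (aff z)).
Proof.
move=> z0; apply/funext => i; rewrite /scale; case: (unliftP ord0 i) => [k|] ->.
  by rewrite ext_lift /aff mulrC divfK.
by rewrite ext0 mulr1.
Qed.

Lemma aff_eq x z : z ord0 != 0 -> x ord0 != 0 -> aff x = aff z ->
  x = scale (x ord0 / z ord0) z.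
Proof.
move=> z0 x0 xz; apply/funext => i; rewrite /scale.
have -> : x i = x ord0 * ext 1 (aff z) i by rewrite {1}(scale_aff x0) xz.
have -> : z i = z ord0 * ext 1 (aff z) i by rewrite {1}(scale_aff z0).
by rewrite mulrA divfK.
Qed.

Lemma aff_cmod z k : Cn1 z -> cmod (aff z k) <= 1.
Proof.
move=> /Cn1_aff[_ h]; rewrite -(ler_pXn2r (n:=2)) ?nnegrE ?cmod_ge0// expr1n.
apply: le_trans (ltW h); rewrite /nsq (bigD1 k)//= lerDl.
by apply: sumr_ge0 => i _; exact: sqr_ge0.
Qed.

Lemma Cn1_near p d s : Cn1 (line p d s) ->
  exists2 r : R, 0 < r & forall t, cmod (t - s) < r -> Cn1 (line p d t).
Proof.
move=> hs; pose h t := herm (line p d t) (line p d t).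
have ch : ccont h s.
  have cl i : ccont (fun t => p i + t * d i) s.
    by apply: ccontD; [|apply: ccontM]; [exact: ccont_cst|exact: ccont_id|exact: ccont_cst].
  apply: ccont_sum => j; apply: ccontM; last exact/ccont_conj/cl.
  by apply: ccontM; [exact: ccont_cst|exact: cl].
have hneg : 0 < - hform (line p d s) by rewrite oppr_gt0.
have [r r0 hr] := ch _ hneg; exists r => // t /hr.
rewrite /h !hermxx -rmorphB cmod_real /Cn1 -/(hform _) ltr_norml.
by move=> /andP[_]; lra.
Qed.

(** Arbitrary base points and directions make the notion stable under linear maps on either side, as
    the normalisation by a reflection requires. *)
Definition lineholo F := forall i p d s, Cn1 (line p d s) ->
  cdiff (fun t => F (line p d t) i) s.

Lemma lineholo_app M F : lineholo F -> lineholo (fun z => app M (F z)).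
Proof.
move=> H i p d s hs; apply: cdiff_sum => j.
by apply: cdiffM; [exact: cdiff_cst|exact: H].
Qed.

Lemma lineholo_precomp M F : (forall z, Cn1 z -> Cn1 (app M z)) -> lineholo F ->
  lineholo (fun z => F (app M z)).
Proof.
move=> hM H i p d s hs.
under eq_fun do rewrite app_line.
by apply: H; rewrite -app_line; exact: hM.
Qed.

Lemma lineholo_aff F k p d s : lineholo F -> (forall z, Cn1 z -> Cn1 (F z)) ->
  Cn1 (line p d s) -> cdiff (fun t => aff (F (line p d t)) k) s.
Proof.
move=> H FC hs; apply: cdiff_div; [exact: H|exact: H|exact/Cn1_neq0/FC].
Qed.

Lemma scale_line s z : scale s z = line (fun=> 0) z s.
Proof. by apply/funext => i; rewrite /line add0r. Qed.

Lemma aff_scale_invariant F z s : lineholo F -> (forall z, Cn1 z -> Cn1 (F z)) ->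
  Cn1 z -> s != 0 -> aff (F (scale s z)) = aff (F z).
Proof.
move=> H FC hz s0; have z1 : scale 1 z = z by apply/funext => i; exact: mul1r.
apply/funext => k; rewrite -{2}z1 !scale_line.
apply: (@liouville_punctured _ (fun t => aff (F (line (fun=> 0) z t)) k) 1) => //.
  by move=> t t0; apply: lineholo_aff => //; rewrite -scale_line; exact: Cn1_scale.
by move=> t t0; apply/aff_cmod/FC; rewrite -scale_line; exact: Cn1_scale.
Qed.

(** Termwise, |a b| <= (|a|^2 + |b|^2) / 2; with a common bound on both norms this takes the place
    of Cauchy-Schwarz. *)
Lemma dot_le m (v1 v2 : 'I_m -> C) (N : R) : nsq v1 <= N -> nsq v2 <= N ->
  cmod (\sum_k v1 k * (v2 k)^*%C) <= N.
Proof.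
move=> h1 h2; have -> : N = (N + N) / 2 by field.
apply: (@le_trans _ _ ((nsq v1 + nsq v2) / 2)); last by rewrite ler_pM2r ?invr_gt0// lerD.
rewrite /nsq -big_split /= mulr_suml.
elim/big_ind2: _ => [|x1 x2 y1 y2 hx hy|k _]; first by rewrite cmod0.
  by apply: le_trans (cmodD _ _) _; exact: lerD.
rewrite cmodM cmodC; have := sqr_ge0 (cmod (v1 k) - cmod (v2 k)).
by rewrite sqrrB; lra.
Qed.

Lemma dot_self m (v : 'I_m -> C) : \sum_k v k * (v k)^*%C = ((nsq v)%:C)%C.
Proof. by rewrite rmorph_sum; apply: eq_bigr => k _; exact: mul_conjc. Qed.

End NegativeCone.

(** * The Schwarz lemma on the ball *)

Section BallSchwarz.
Variables (R : realType) (n : nat).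
Local Notation C := R[i].
Local Notation vec := ('I_n.+1 -> C).
Implicit Types (x y z u v p d : vec) (a b s : C) (A M D : 'M[C]_n.+1) (F G : vec -> vec)
  (w : 'I_n -> C).

(** One matrix serves all directions [d]; this linearity is what holomorphy on separate lines does
    not provide. *)
Definition has_gradient F D := forall i d, exists q : C -> C,
  [/\ ccont q 0, q 0 = \sum_k D i k * d k &
      forall s, F (line (@e0 R n) d s) i = F (@e0 R n) i + q s * s].

Lemma line_e0 w s : line (@e0 R n) (ext 0 w) s = ext 1 (fun k => s * w k).
Proof.
apply/funext => i; rewrite /line /e0; case: (unliftP ord0 i) => [k|] ->.
  by rewrite !ext_lift (_ : lift ord0 k == ord0 = false)// add0r.
by rewrite !ext0 eqxx mulr0 addr0.
Qed.

Lemma e0_ext : @e0 R n = ext 1 (fun=> 0).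
Proof.
rewrite -[LHS](_ : line (@e0 R n) (ext 0 (fun=> 0)) 0 = _); last first.
  by apply/funext => i; rewrite /line mul0r addr0.
by rewrite line_e0; congr ext; apply/funext => k; rewrite mulr0.
Qed.

Lemma nsq_zero m : nsq (fun _ : 'I_m => 0 : C) = 0.
Proof. by rewrite /nsq big1// => k _; rewrite cmod0 expr0n. Qed.

Lemma nsq_eq0 m (v : 'I_m -> C) : nsq v = 0 -> v = fun=> 0.
Proof.
move/eqP; rewrite psumr_eq0 => [/allP h|k _]; last exact: sqr_ge0.
apply/funext => k; apply/eqP; rewrite -cmod_eq0 -sqrf_eq0.
by apply: h; rewrite mem_index_enum.
Qed.

Lemma Cn1_e0 : Cn1 (@e0 R n).
Proof. by rewrite e0_ext; apply: Cn1_ext; rewrite nsq_zero. Qed.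

Lemma Cn1_line_e0 w s : cmod s < 1 -> nsq w <= 1 -> Cn1 (line (@e0 R n) (ext 0 w) s).
Proof.
move=> s1 w1; rewrite line_e0; apply: Cn1_ext; rewrite nsq_scale.
apply: le_lt_trans (_ : cmod s ^+ 2 < 1); last by rewrite exprn_ilt1 ?cmod_ge0.
by rewrite ler_piMr ?sqr_ge0.
Qed.

Lemma aff_e0 F : (forall k, F (@e0 R n) (lift ord0 k) = 0) -> aff (F (@e0 R n)) = fun=> 0.
Proof. by move=> H; apply/funext => k; rewrite /aff H mul0r. Qed.

(** Reduction to one variable: restrict to the disc through w / |w| and pair the image with the unit
    vector y / |y|. The resulting self-map of the disc fixes 0 and sends |w| to |y|. *)
Lemma ball_schwarz F z : lineholo F -> (forall z, Cn1 z -> Cn1 (F z)) ->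
  (forall k, F (@e0 R n) (lift ord0 k) = 0) -> Cn1 z ->
  nsq (aff (F z)) <= nsq (aff z).
Proof.
move=> HF FC F0 hz; have [z0 hw] := (Cn1_aff z).1 hz.
set w := aff z in hw *.
have zE : aff (F z) = aff (F (ext 1 w)).
  rewrite {1}(scale_aff z0); apply: aff_scale_invariant => //; exact: Cn1_ext.
rewrite zE; set y := aff _.
have hy : nsq y < 1 by have [_] := (Cn1_aff _).1 (FC _ (Cn1_ext hw)).
have [N0|N0] := eqVneq (nsq w) 0.
  by rewrite N0 /y (nsq_eq0 N0) -e0_ext aff_e0// nsq_zero.
have [Y0|Y0] := eqVneq (nsq y) 0; first by rewrite Y0 nsq_ge0.
have Np : 0 < nsq w by rewrite lt_def N0 nsq_ge0.
have Yp : 0 < nsq y by rewrite lt_def Y0 nsq_ge0.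
pose rho := Num.sqrt (nsq w); pose sg := Num.sqrt (nsq y).
have rho0 : 0 < rho by rewrite sqrtr_gt0.
have sg0 : 0 < sg by rewrite sqrtr_gt0.
have rho2 : rho ^+ 2 = nsq w by rewrite sqr_sqrtr// nsq_ge0.
have sg2 : sg ^+ 2 = nsq y by rewrite sqr_sqrtr// nsq_ge0.
have rho1 : rho < 1 by rewrite -(ltr_pXn2r (n:=2)) ?nnegrE ?(ltW rho0)// rho2 expr1n.
pose inv (t : R) : C := ((t^-1)%:C)%C.
have invn m (t : R) (v : 'I_m -> C) : 0 < t -> nsq v = t ^+ 2 ->
    nsq (fun k => inv t * v k) = 1.
  move=> t0 hv; rewrite nsq_scale hv cmod_real normrV ?unitfE ?gt_eqF// gtr0_norm//.
  by rewrite exprVn mulVf// gt_eqF// exprn_gt0.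
pose d k := inv rho * w k; pose y' k := inv sg * y k.
have d1 : nsq d = 1 by apply: invn.
have y1 : nsq y' = 1 by apply: invn.
pose L := line (@e0 R n) (ext 0 d).
have LC s : cmod s < 1 -> Cn1 (L s) by move=> s1; apply: Cn1_line_e0; rewrite ?d1.
pose k s := \sum_j aff (F (L s)) j * (y' j)^*%C.
have kd s : cmod s < 1 -> cdiff k s.
  move=> s1; apply: cdiff_sum => j; apply: cdiffM; last exact: cdiff_cst.
  by apply: lineholo_aff => //; exact: LC.
have L0 : L 0 = @e0 R n by apply/funext => i; rewrite /L /line mul0r addr0.
have k0 : k 0 = 0 by rewrite /k L0 aff_e0// big1// => j _; rewrite mul0r.
have k1 s : cmod s < 1 -> cmod (k s) <= 1.
  move=> s1; apply: dot_le; last by rewrite y1.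
  by have [_ /ltW] := (Cn1_aff _).1 (FC _ (LC _ s1)).
have rC : cmod ((rho%:C)%C : C) = rho by rewrite cmod_real gtr0_norm.
have := @schwarz _ k kd k0 k1 (rho%:C)%C; rewrite rC => /(_ rho1).
have Lr : L (rho%:C)%C = ext 1 w.
  rewrite /L line_e0; congr ext; apply/funext => j; rewrite /d /inv mulrA -rmorphM /=.
  by rewrite divff ?gt_eqF// mul1r.
have -> : k (rho%:C)%C = (sg%:C)%C.
  rewrite /k Lr -/y /y'.
  under eq_bigr => j _ do rewrite rmorphM /= mulrCA.
  rewrite -mulr_sumr dot_self -sg2.
  apply/eqP; rewrite eq_complex /=; apply/andP; split; apply/eqP; field; exact: lt0r_neq0.
rewrite cmod_real gtr0_norm// -sg2 -rho2 => h.
by rewrite ler_pXn2r ?nnegrE ?(ltW sg0) ?(ltW rho0).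
Qed.

Lemma ccont_limit_eq (m : C -> C) (c : C) : ccont m 0 ->
  (forall s, s != 0 -> cmod s < 1 -> m s = c) -> m 0 = c.
Proof.
move=> mc H; apply/eqP; rewrite -subr_eq0 -cmod_eq0; apply: contraT => h.
have h0 : 0 < cmod (m 0 - c) by rewrite lt_def h cmod_ge0.
have [del del0 hd] := mc _ h0; pose t := Num.min del 1 / 2.
have m0 : 0 < Num.min del 1 by rewrite lt_min del0 ltr01.
have t0 : 0 < t by rewrite divr_gt0.
have : t < Num.min del 1 by rewrite ltr_pdivrMr// ltr_pMr// ltr1n.
rewrite lt_min => /andP[td t1].
have tc : cmod ((t%:C)%C : C) = t by rewrite cmod_real gtr0_norm.
have := hd (t%:C)%C; rewrite subr0 tc H ?tc// -?cmod_gt0 ?tc// => /(_ td).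
by rewrite cmodB ltxx.
Qed.

Lemma nsqB m (v1 v2 : 'I_m -> C) : nsq (fun k => v1 k - v2 k) =
  nsq v1 + nsq v2 - 2 * complex.Re (\sum_k v1 k * (v2 k)^*%C).
Proof.
rewrite /nsq -big_split /=.
elim/big_rec3: _ => [|k x1 x2 x3 _ ->]; first by rewrite mulr0 subr0.
rewrite ReD !cmod_sqr; case: (v1 k) (v2 k) => a b [c e] /=; ring.
Qed.

(** * Automorphisms of the ball fixing the centre *)

Section FixedCenter.
Variables (F G : vec -> vec) (D : 'M[C]_n.+1).
Hypotheses (HF : lineholo F) (HG : lineholo G).
Hypotheses (FC : forall z, Cn1 z -> Cn1 (F z)) (GC : forall z, Cn1 z -> Cn1 (G z)).
Hypothesis GF : forall z, Cn1 z -> G (F z) = z.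
Hypotheses (F0 : forall k, F (@e0 R n) (lift ord0 k) = 0)
           (G0 : forall k, G (@e0 R n) (lift ord0 k) = 0).
Hypothesis gradF : has_gradient F D.

Lemma aff_isometry z : Cn1 z -> nsq (aff (F z)) = nsq (aff z).
Proof.
move=> hz; apply/le_anti; rewrite ball_schwarz//=.
by have := ball_schwarz HG GC G0 (FC hz); rewrite GF.
Qed.

(** The derivative at the centre of the ball map induced by [F]: since F_k vanishes at [e0] for k >=
    1, the quotient rule leaves only the derivative of the numerator. *)
Definition linear_part w : 'I_n -> C :=
  fun k => (\sum_j D (lift ord0 k) (lift ord0 j) * w j) / F (@e0 R n) ord0.

Lemma linear_part_scale s w : linear_part (fun k => s * w k) = fun k => s * linear_part w k.
Proof.
apply/funext => k; rewrite /linear_part mulrA; congr (_ / _); rewrite mulr_sumr.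
by apply: eq_bigr => j _; ring.
Qed.

(** Along the ray, [P] has constant squared norm N, so Re (N - <P s, P 0>) >= 0 with value 0 at s =
    0. By [Re_ge0_eq0] the difference vanishes, which is equality in Cauchy-Schwarz and gives P s =
    P 0. *)
Lemma aff_ray w : nsq w < 1 -> nsq (linear_part w) = nsq w /\
  forall s, cmod s < 1 -> aff (F (ext 1 (fun k => s * w k))) = fun k => s * linear_part w k.
Proof.
move=> w1; set N := nsq w.
pose L := line (@e0 R n) (ext 0 w).
have LC s : cmod s < 1 -> Cn1 (L s) by move=> s1; apply: Cn1_line_e0; rewrite ?ltW.
have L0 : L 0 = @e0 R n by apply/funext => i; rewrite /L /line mul0r addr0.
have LE s : L s = ext 1 (fun k => s * w k) by exact: line_e0.
have [q hq] := choice (fun k => gradF (lift ord0 k) (ext 0 w)).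
(* Written through the quotients [q] rather than as a division by [s], so that [P] is continuous at
   0 and P 0 is the derivative. *)
pose P s (k : 'I_n) := q k s / F (L s) ord0.
have aP s : aff (F (L s)) = fun k => s * P s k.
  apply/funext => k; rewrite /aff /P; have [_ _ ->] := hq k.
  by rewrite F0 add0r mulrA [q k s * s]mulrC.
have f0 : F (L 0) ord0 != 0 by rewrite L0; exact/Cn1_neq0/FC/Cn1_e0.
have C01 : cmod (0 : C) < 1 by rewrite cmod0.
have Pc0 k : ccont (P ^~ k) 0.
  have [qc _ _] := hq k; apply: ccontM => //; apply: ccontV => //.
  by apply: cdiff_cont; apply: HF; exact: LC C01.
have P0 : P 0 = linear_part w.
  apply/funext => k; rewrite /P L0 /linear_part; have [_ -> _] := hq k.
  rewrite big_ord_recl ext0 mulr0 add0r; congr (_ / _).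
  by apply: eq_bigr => j _; rewrite ext_lift.
have Pd k s : s != 0 -> cmod s < 1 -> cdiff (P ^~ k) s.
  move=> s0 s1; apply: (@cdiff_near _ (fun t => aff (F (L t)) k / t) _ s (cmod s)).
  - by rewrite cmod_gt0.
  - move=> t ht; rewrite aP mulrAC divff ?mul1r//.
    by apply: contraTneq ht => ->; rewrite sub0r cmodN ltxx.
  - by apply: cdiff_div => //; [apply: lineholo_aff => //; exact: LC|exact: cdiff_id].
have PN s : s != 0 -> cmod s < 1 -> nsq (P s) = N.
  move=> s0 s1; have := aff_isometry (LC _ s1).
  rewrite aP LE aff_ext !nsq_scale.
  rewrite (_ : (fun k => s * w k / 1) = fun k => s * w k); last first.
    by apply/funext => k; rewrite divr1.
  rewrite nsq_scale; apply: mulfI.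
  by rewrite gt_eqF// exprn_gt0// cmod_gt0.
have P0N : nsq (P 0) = N.
  apply: (complexI (R := R)); rewrite -dot_self.
  apply: (@ccont_limit_eq (fun s => \sum_k P s k * (P s k)^*%C)).
    by apply: ccont_sum => k; apply: ccontM => //; exact: ccont_conj.
  by move=> s s0 s1; rewrite dot_self PN.
split; first by rewrite -P0.
pose h s := (N%:C)%C - \sum_k P s k * (P 0 k)^*%C.
have NP s : cmod s < 1 -> nsq (P s) = N.
  by move=> s1; have [->//|s0] := eqVneq s 0; exact: PN.
have hc s : cmod s < 1 -> ccont h s.
  move=> s1; apply: ccontB; first exact: ccont_cst.
  apply: ccont_sum => k; apply: ccontM; last exact: ccont_cst.
  by have [->//|s0] := eqVneq s 0; exact/cdiff_cont/Pd.
have hd s : cmod s < 1 -> s != 0 -> cdiff h s.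
  move=> s1 s0; apply: cdiffB; first exact: cdiff_cst.
  by apply: cdiff_sum => k; apply: cdiffM; [exact: Pd|exact: cdiff_cst].
have h0 : h 0 = 0 by rewrite /h dot_self P0N subrr.
have hR s : cmod s < 1 -> 0 <= complex.Re (h s).
  move=> s1; rewrite /h ReB /= subr_ge0; apply: le_trans (Re_le_cmod _) _.
  by apply: dot_le; rewrite ?NP// P0N.
move=> s s1; rewrite -LE aP -P0; apply/funext => k; congr (_ * _).
have := Re_ge0_eq0 hc hd h0 hR s1 => /eqP; rewrite subr_eq0 => /eqP hs.
apply/eqP; rewrite -subr_eq0; apply/eqP.
have : nsq (fun k => P s k - P 0 k) = 0.
  by rewrite nsqB -hs NP// P0N /=; ring.
by move/nsq_eq0/(congr1 (fun v' : 'I_n -> C => v' k)).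
Qed.

Lemma aff_linear z : Cn1 z -> aff (F z) = linear_part (aff z).
Proof.
move=> hz; have [z0 w1] := (Cn1_aff z).1 hz.
rewrite {1}(scale_aff z0) aff_scale_invariant//; last exact: Cn1_ext.
set w := aff z in w1 *; have w0 : 0 <= nsq w := nsq_ge0 w.
(* [aff_ray] reaches s w' only for |s| < 1, so w is written as r w' with |w| < r < 1; the mean of
   |w|^2 and 1 has nsq w < r^2 by (1 - nsq w)^2 > 0. *)
pose r := (nsq w + 1) / 2.
have r0 : 0 < r by rewrite divr_gt0// ltr_wpDl.
have r1 : r < 1 by rewrite /r; lra.
have r2 : nsq w < r ^+ 2.
  have : 0 < (1 - nsq w) ^+ 2 by rewrite exprn_gt0// subr_gt0.
  by rewrite /r; lra.
have rC : ((r%:C)%C : C) != 0 by rewrite -cmod_gt0 cmod_real gtr0_norm.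
pose w' k := ((r%:C)%C)^-1 * w k.
have w'E : w = fun k => (r%:C)%C * w' k by apply/funext => k; rewrite /w' mulVKf.
have w'1 : nsq w' < 1.
  rewrite nsq_scale cmodV cmod_real gtr0_norm// exprVn mulrC ltr_pdivrMr ?exprn_gt0//.
  by rewrite mul1r.
have [_ H] := aff_ray w'1.
have := H (r%:C)%C; rewrite cmod_real gtr0_norm// => /(_ r1).
by rewrite -w'E -linear_part_scale -w'E.
Qed.

Lemma linear_part_isometry w : nsq (linear_part w) = nsq w.
Proof.
(* A factor bringing any [w] into the ball, where [aff_ray] applies; homogeneity removes it
   again. *)
pose r := (nsq w + 1)^-1; have w0 := nsq_ge0 w.
have r0 : 0 < r by rewrite invr_gt0 ltr_wpDl.
have rC : cmod ((r%:C)%C : C) = r by rewrite cmod_real gtr0_norm.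
have h1 : nsq (fun k => (r%:C)%C * w k) < 1.
  rewrite nsq_scale rC /r exprVn mulrC ltr_pdivrMr ?exprn_gt0 ?ltr_wpDl// mul1r.
  by have := sqr_ge0 (nsq w); lra.
have [] := aff_ray h1; rewrite linear_part_scale !nsq_scale rC => + _.
by apply: mulfI; rewrite gt_eqF// exprn_gt0.
Qed.

End FixedCenter.

End BallSchwarz.
(** * Automorphisms of the negative cone *)

Section ConeAutomorphisms.
Variables (R : realType) (n : nat).
Local Notation C := R[i].
Local Notation vec := ('I_n.+1 -> C).
Implicit Types (x y z u v p d : vec) (a b s : C) (A M D : 'M[C]_n.+1) (F G f g : vec -> vec)
  (w : 'I_n -> C).

(** The vector [c] is chosen before the direction [d], which is what makes the directional
    derivatives linear in [d]. *)
Lemma holomorphic_line (phi : vec -> C) p : holomorphic_on (@Cn1 R n) phi -> Cn1 p ->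
  exists c : vec, forall d, exists q : C -> C,
    [/\ ccont q 0, q 0 = \sum_k c k * d k &
        forall s, phi (line p d s) = phi p + q s * s].
Proof.
move=> H hp; have [c hc] := H p hp; exists c => d.
have l0 : line p d 0 = p by apply/funext => i; rewrite /line mul0r addr0.
have [r r0 hr] : exists2 r : R, 0 < r & forall t, cmod (t - 0) < r -> Cn1 (line p d t).
  by apply: Cn1_near; rewrite l0.
have [|q [qc q0] hq] := @cdiffP _ (fun s => phi (line p d s)) 0 (\sum_k c k * d k).
  (* The added 1 permits division by [V] when d = 0. *)
  move=> e e_gt0; pose V := vnorm d + 1.
  have V0 : 0 <= vnorm d by apply: sumr_ge0 => i _; exact: cmod_ge0.
  have V1 : 0 < V by rewrite ltr_wpDl.
  have [del del0 hdel] := hc _ (divr_gt0 e_gt0 V1).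
  exists (Num.min r (del / V)); first by rewrite lt_min r0 divr_gt0.
  move=> s; rewrite subr0 lt_min ltr_pdivlMr// => /andP[sr sd].
  pose h i := s * d i.
  have hn : vnorm h = cmod s * vnorm d.
    by rewrite /vnorm mulr_sumr; apply: eq_bigr => i _; rewrite cmodM.
  have lE : line p d s = vadd p h by [].
  have hlt : vnorm h < del.
    by rewrite hn; apply: le_lt_trans sd; rewrite ler_wpM2l ?cmod_ge0// lerDl.
  have hU : Cn1 (vadd p h) by rewrite -lE; apply: hr; rewrite subr0.
  have := hdel h hlt hU; rewrite l0 lE.
  have -> : \sum_i c i * h i = (\sum_k c k * d k) * s.
    by rewrite mulr_suml; apply: eq_bigr => i _; rewrite /h; ring.
  move=> /le_trans; apply; rewrite hn.
  have -> : e / V * (cmod s * vnorm d) = e * cmod s * (vnorm d / V).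
    by field; exact: lt0r_neq0.
  rewrite ler_piMr ?mulr_ge0 ?cmod_ge0 ?(ltW e_gt0)// ler_pdivrMr// mul1r lerDl//.
exists q; split=> // s; by rewrite hq l0 subr0.
Qed.

Lemma holomorphic_lineholo f : holomorphic_map_on (@Cn1 R n) f -> lineholo f.
Proof.
move=> H i p d s hs; have [c hc] := holomorphic_line (H i) hs.
have [q [qc _ hq]] := hc d.
apply: (@cdiff_near _ (fun t => f (line (line p d s) d (t - s)) i) _ s 1) => //.
  move=> t _; congr (f _ i); apply/funext => j; rewrite /line; ring.
apply: (@cdiff_comp _ (fun t => f (line (line p d s) d t) i) (fun t => t - s)).
  by apply: cdiffB; [exact: cdiff_id|exact: cdiff_cst].
rewrite subrr; apply: (@cdiffI _ _ q _ 1) => // t _.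
rewrite hq subr0; congr (f _ i + _); apply/funext => j; rewrite /line mul0r addr0//.
Qed.

Lemma holomorphic_gradient f : holomorphic_map_on (@Cn1 R n) f ->
  exists D, has_gradient f D.
Proof.
move=> H; have [c hc] := choice (fun i => holomorphic_line (H i) (@Cn1_e0 R n)).
exists (\matrix_(i, k) c i k) => i d; have [q [h1 h2 h3]] := hc i d.
by exists q; split=> //; rewrite h2; apply: eq_bigr => k _; rewrite mxE.
Qed.

Lemma app_gradient f D M : has_gradient f D -> has_gradient (fun z => app M (f z)) (M *m D).
Proof.
move=> H i d; have [q hq] := choice (fun j => H j d).
exists (fun s => \sum_j M i j * q j s); split.
- apply: ccont_sum => j; apply: ccontM; first exact: ccont_cst.
  by have [] := hq j.
- transitivity (app M (app D d) i); last by rewrite -app_mul.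
  by apply: eq_bigr => j _; have [_ -> _] := hq j.
- move=> s; rewrite /app mulr_suml -big_split; apply: eq_bigr => j _ /=.
  by have [_ _ ->] := hq j; ring.
Qed.

(** By scale invariance of [aff], f maps the punctured line through z to the one through v = (1, aff
    (f z)). In the coordinates s -> scale s z and s -> scale s v it becomes S, with inverse T, to
    which [punctured_plane_aut] applies. *)
Lemma fiber_dichotomy f g z : lineholo f -> lineholo g ->
  (forall z, Cn1 z -> Cn1 (f z)) -> (forall z, Cn1 z -> Cn1 (g z)) ->
  (forall z, Cn1 z -> g (f z) = z) -> (forall z, Cn1 z -> f (g z) = z) ->
  Cn1 z ->
  (forall s, s != 0 -> f (scale s z) ord0 = s * f z ord0) \/
  (forall s, s != 0 -> f (scale s z) ord0 = s^-1 * f z ord0).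
Proof.
move=> Hf Hg fC gC gf fg hz; have z0 := Cn1_neq0 hz.
pose v := ext 1 (aff (f z)).
have fz0 := Cn1_neq0 (fC _ hz).
have hv : Cn1 v by apply: Cn1_ext; have [] := (Cn1_aff _).1 (fC _ hz).
pose S s := f (scale s z) ord0; pose T s := g (scale s v) ord0 / z ord0.
have fS s : s != 0 -> f (scale s z) = scale (S s) v.
  move=> s0; have hs := fC _ (Cn1_scale s0 hz).
  by rewrite {1}(scale_aff (Cn1_neq0 hs)) aff_scale_invariant.
have gT s : s != 0 -> g (scale s v) = scale (T s) z.
  move=> s0; apply: aff_eq => //; first exact/Cn1_neq0/gC/Cn1_scale.
  rewrite aff_scale_invariant// -[in RHS](gf _ hz).
  by rewrite [in RHS](scale_aff fz0) aff_scale_invariant.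
have S0 s : s != 0 -> S s != 0 by move=> s0; exact/Cn1_neq0/fC/Cn1_scale.
have T0 s : s != 0 -> T s != 0.
  by move=> s0; rewrite mulf_neq0 ?invr_eq0//; exact/Cn1_neq0/gC/Cn1_scale.
have ST : left_inverse_off0 S T.
  move=> s s0; split; first exact: S0.
  rewrite /T -fS// gf; last exact: Cn1_scale.
  by rewrite /scale mulfK.
have TS : left_inverse_off0 T S.
  move=> s s0; split; first exact: T0.
  rewrite /S -gT// fg; last exact: Cn1_scale.
  by rewrite /scale /v ext0 mulr1.
have Sd s : s != 0 -> cdiff S s.
  move=> s0; rewrite /S; under eq_fun do rewrite scale_line.
  by apply: Hf; rewrite -scale_line; exact: Cn1_scale.
have Td s : s != 0 -> cdiff T s.
  move=> s0; rewrite /T; under eq_fun do rewrite scale_line.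
  apply: cdiffM; last exact: cdiff_cst.
  by apply: Hg; rewrite -scale_line; exact: Cn1_scale.
have z1 : scale 1 z = z by apply/funext => i; exact: mul1r.
have [c c0 [H|H]] := punctured_plane_aut Sd Td ST TS; [left|right] => s s0.
  by have := H 1 (oner_neq0 _); have := H s s0; rewrite /S z1 mulr1 => -> ->; rewrite mulrC.
by have := H 1 (oner_neq0 _); have := H s s0; rewrite /S z1 invr1 mulr1 => -> ->; rewrite mulrC.
Qed.

(** Each fibre is parametrised from its point (1, aff z) with parameter z_0. All fibres are compared
    with that of [e0] along the segment from the centre to [w]. *)
Lemma uniform_dichotomy f g : lineholo f -> lineholo g ->
  (forall z, Cn1 z -> Cn1 (f z)) -> (forall z, Cn1 z -> Cn1 (g z)) ->
  (forall z, Cn1 z -> g (f z) = z) -> (forall z, Cn1 z -> f (g z) = z) ->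
  (forall z, Cn1 z -> f z ord0 = f (ext 1 (aff z)) ord0 * z ord0) \/
  (forall z, Cn1 z -> f z ord0 = f (ext 1 (aff z)) ord0 * (z ord0)^-1).
Proof.
move=> Hf Hg fC gC gf fg.
have dich z := @fiber_dichotomy f g z Hf Hg fC gC gf fg.
have two0 : (2 : C) != 0 by rewrite pnatr_eq0.
(* The ratio below only takes the values 2 and 1/2, hence is constant on segments. *)
pose tau z := complex.Re (f (scale 2 z) ord0 / f z ord0).
have Re2 : complex.Re (2 : C) = 2 by rewrite -(rmorph_nat (real_complex R)).
have Re2V : complex.Re ((2 : C)^-1) = 2^-1.
  have -> : (2 : C)^-1 = ((2^-1)%:C)%C by rewrite fmorphV rmorph_nat.
  by [].
have tauL z : Cn1 z -> (forall s, s != 0 -> f (scale s z) ord0 = s * f z ord0) -> tau z = 2.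
  by move=> hz H; rewrite /tau H// mulfK ?(Cn1_neq0 (fC _ hz)).
have tauR z : Cn1 z -> (forall s, s != 0 -> f (scale s z) ord0 = s^-1 * f z ord0) ->
    tau z = 2^-1.
  by move=> hz H; rewrite /tau H// mulfK ?(Cn1_neq0 (fC _ hz)).
have tauP z : Cn1 z -> (tau z = 2 \/ tau z = 2^-1).
  by move=> hz; case: (dich z hz) => H; [left; exact: tauL|right; exact: tauR].
have tau_const w : nsq w < 1 -> tau (ext 1 w) = tau (@e0 R n).
  move=> w1; pose l (t : R) := line (@e0 R n) (ext 0 w) (t%:C)%C.
  have l0 : l 0 = @e0 R n by apply/funext => i; rewrite /l /line mul0r addr0.
  have l1 : l 1 = ext 1 w.
    by rewrite /l line_e0; congr ext; apply/funext => k; exact: mul1r.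
  have lC t : 0 <= t <= 1 -> Cn1 (l t).
    move=> /andP[t0 t1]; rewrite /l line_e0; apply: Cn1_ext.
    rewrite nsq_scale cmod_real ger0_norm//.
    by apply: le_lt_trans w1; rewrite ler_piMl ?nsq_ge0// exprn_ile1.
  have cont t : 0 <= t <= 1 -> cont_at (fun t => tau (l t)) t.
    move=> ht; have hlt := lC t ht.
    have kd : cdiff (fun s => f (scale 2 (line (@e0 R n) (ext 0 w) s)) ord0 /
        f (line (@e0 R n) (ext 0 w) s) ord0) (t%:C)%C.
      have sl s : scale 2 (line (@e0 R n) (ext 0 w) s) =
          line (scale 2 (@e0 R n)) (scale 2 (ext 0 w)) s.
        by apply/funext => i; rewrite /scale /line; ring.
      apply: cdiff_div; [under eq_fun do rewrite sl|exact: Hf|exact/Cn1_neq0/fC].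
      by apply: Hf; rewrite -sl; exact: Cn1_scale.
    move=> e e_gt0; have [d d0 hd] := cdiff_cont kd e_gt0; exists d => // y hy.
    rewrite /tau /l -ReB; apply: le_lt_trans (normr_Re_cmod _) _; apply: hd.
    by rewrite -rmorphB cmod_real.
  have h10 : 0 <= (1 : R) <= 1 by rewrite ler01 lexx.
  have h00 : 0 <= (0 : R) <= 1 by rewrite ler01 lexx.
  have h21 : 2^-1 < 1 :> R by rewrite invf_lt1// ltr1n.
  rewrite -l0 -l1; have := tauP _ (lC 1 h10); have := tauP _ (lC 0 h00).
  have := @IVT R (fun t => tau (l t)) 0 1 1 ler01 (cont_within cont).
  (* If the values at the ends differ, [tau] takes the intermediate value 1, which is neither 2 nor
     1/2. *)
  move=> ivt [E0|E0] [E1|E1]; rewrite ?E0 ?E1//; exfalso.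
    have [|t] := ivt; first by rewrite E0 E1 ge_min le_max ler1n (ltW h21) orbT.
    rewrite in_itv /= => ht tE; have := tauP _ (lC t ht); rewrite tE.
    by move=> [/eqP|/eqP]; [rewrite -[1]/(1%:R) eqr_nat|rewrite gt_eqF].
  have [|t] := ivt; first by rewrite E0 E1 ge_min le_max ler1n (ltW h21) orbT.
  rewrite in_itv /= => ht tE; have := tauP _ (lC t ht); rewrite tE.
  by move=> [/eqP|/eqP]; [rewrite -[1]/(1%:R) eqr_nat|rewrite gt_eqF].
have h2 : (2 : R) = 2^-1 -> False.
  by move=> h; have : (2^-1 : R) < 2; [lra|rewrite -h ltxx].
have ball z : Cn1 z -> z ord0 != 0 /\ nsq (aff z) < 1 by move/Cn1_aff.
have [L|L] := dich _ (@Cn1_e0 R n); [left|right] => z hz; have [z0 w1] := ball z hz.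
  rewrite {1}(scale_aff z0); have hw := Cn1_ext w1.
  case: (dich _ hw) => H; first by rewrite H// mulrC.
  by have := tau_const _ w1; rewrite (tauL _ (@Cn1_e0 R n) L) (tauR _ hw H) => /esym/h2.
rewrite {1}(scale_aff z0); have hw := Cn1_ext w1.
case: (dich _ hw) => H; last by rewrite H// mulrC.
by have := tau_const _ w1; rewrite (tauR _ (@Cn1_e0 R n) L) (tauL _ hw H) => /h2.
Qed.

Lemma holomorphic_section f : holomorphic_map_on (@Cn1 R n) f ->
  holomorphic_on (@ball_n R n) (fun w => f (ext 1 w) ord0).
Proof.
move=> H w hw; have [c hc] := H ord0 _ (Cn1_ext hw).
exists (fun k => c (lift ord0 k)) => e e_gt0; have [d d0 hd] := hc e e_gt0.
exists d => // h hn hU.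
have E : ext 1 (vadd w h) = vadd (ext 1 w) (ext 0 h).
  apply/funext => i; rewrite /vadd; case: (unliftP ord0 i) => [k|] ->.
    by rewrite !ext_lift.
  by rewrite !ext0 addr0.
have N : vnorm (ext 0 h) = vnorm h.
  rewrite /vnorm big_ord_recl ext0 cmod0 add0r.
  by apply: eq_bigr => k _; rewrite ext_lift.
have := hd (ext 0 h); rewrite N -E => /(_ hn (Cn1_ext hU)).
rewrite big_ord_recl ext0 mulr0 add0r.
by under eq_bigr do rewrite ext_lift.
Qed.

Lemma isometry_Cn1 M z : (forall x, herm (app M x) (app M x) = herm x x) ->
  Cn1 z -> Cn1 (app M z).
Proof. by move=> H; rewrite /Cn1 -!/(hform _); have := H z; rewrite !hermxx => /complexI->. Qed.

(** The block matrix diag(1, L), with L the matrix of [linear_part]; it is unitary for the Lorentz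
    form once L is an isometry. *)
Definition linear_part_mx F D : 'M[C]_n.+1 := \matrix_(i, j)
  ext (ext 1 (fun=> 0) j)
      (fun k => ext 0 (fun l => D (lift ord0 k) (lift ord0 l) / F (@e0 R n) ord0) j) i.

Lemma app_linear_part_mx F D z :
  app (linear_part_mx F D) z = ext (z ord0) (linear_part F D (fun k => z (lift ord0 k))).
Proof.
apply/funext => i; rewrite /app big_ord_recl !mxE.
under eq_bigr do rewrite mxE.
case: (unliftP ord0 i) => [k|] ->.
  rewrite !ext_lift ext0 mul0r add0r /linear_part mulr_suml.
  by apply: eq_bigr => l _; rewrite !ext_lift; ring.
rewrite !ext0 mul1r big1 ?addr0// => l _.
by rewrite ext0 ext_lift mul0r.
Qed.

(** The reflection M moves f(e0) onto the line of [e0], so F = M f fixes the centre and agrees with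
    the block matrix K up to a scalar. As M is an involution, f is M K up to a scalar. *)
Lemma projective_linear f g : holomorphic_map_on (@Cn1 R n) f -> lineholo g ->
  (forall z, Cn1 z -> Cn1 (f z)) -> (forall z, Cn1 z -> Cn1 (g z)) ->
  (forall z, Cn1 z -> g (f z) = z) ->
  exists2 A, in_Un1 A & forall z, Cn1 z -> exists b, f z = scale b (app A z).
Proof.
move=> holf Hg fC gC gf; have Hf := holomorphic_lineholo holf.
have [M [Mh MM M0]] := reflection_to_e0 (fC _ (@Cn1_e0 R n)).
have MC z : Cn1 z -> Cn1 (app M z) by apply: isometry_Cn1 => x; exact: Mh.
pose F z := app M (f z); pose G z := g (app M z).
have HF : lineholo F by exact: lineholo_app.
have HG : lineholo G by exact: lineholo_precomp.
have FC z : Cn1 z -> Cn1 (F z) by move=> hz; exact/MC/fC.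
have GC z : Cn1 z -> Cn1 (G z) by move=> hz; exact/gC/MC.
have GF z : Cn1 z -> G (F z) = z by move=> hz; rewrite /G /F MM gf.
have [D0 gradf] := holomorphic_gradient holf.
have gradF := app_gradient M gradf; set D := M *m D0 in gradF.
have Fe0 := Cn1_neq0 (FC _ (@Cn1_e0 R n)).
have e00 : @e0 R n ord0 != 0 by rewrite /e0 eqxx oner_neq0.
have affe0 : aff (@e0 R n) = fun=> 0.
  by apply/funext => k; rewrite /aff /e0 (_ : lift ord0 k == ord0 = false)// mul0r.
(* F(e0) is a multiple of e0 and G sends it to e0; since [aff] of G is constant on punctured lines,
   G fixes the centre too. *)
have G0 k : G (@e0 R n) (lift ord0 k) = 0.
  have E : F (@e0 R n) = scale (F (@e0 R n) ord0 / @e0 R n ord0) (@e0 R n).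
    by apply: aff_eq => //; rewrite affe0 aff_e0.
  have k0 : F (@e0 R n) ord0 / @e0 R n ord0 != 0 by rewrite mulf_neq0 ?invr_eq0.
  have := GF _ (@Cn1_e0 R n) => /(congr1 (@aff R n)).
  rewrite E aff_scale_invariant//; last exact: Cn1_e0.
  rewrite affe0 => /(congr1 (fun v' : 'I_n -> C => v' k))/eqP.
  by rewrite /aff mulf_eq0 invr_eq0 (negbTE (Cn1_neq0 (GC _ (@Cn1_e0 R n)))) orbF => /eqP.
pose K := linear_part_mx F D.
have KE := app_linear_part_mx F D.
have Kiso x : herm (app K x) (app K x) = herm x x.
  rewrite !hermxx; congr (_%:C)%C; rewrite KE /hform ext0; congr (_ + _).
  rewrite -[RHS]/(nsq (fun k => x (lift ord0 k))).
  rewrite -(linear_part_isometry HF HG FC GC GF M0 G0 gradF).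
  by apply: eq_bigr => k _; rewrite ext_lift.
exists (M *m K).
  apply: in_Un1P => x y; rewrite !app_mul Mh.
  exact: isometry_polarization.
move=> z hz; have z0 := Cn1_neq0 hz.
have Kz : Cn1 (app K z) by exact: isometry_Cn1.
have aE : aff (F z) = aff (app K z).
  rewrite (aff_linear HF HG FC GC GF M0 G0 gradF hz).
  have -> : aff z = fun k => (z ord0)^-1 * z (lift ord0 k).
    by apply/funext => k; rewrite /aff mulrC.
  rewrite linear_part_scale; apply/funext => k.
  by rewrite /aff KE ext_lift ext0 mulrC.
have FE := aff_eq (Cn1_neq0 Kz) (Cn1_neq0 (FC _ hz)) aE.
exists (F z ord0 / app K z ord0).
rewrite -[LHS]MM -/(F z) {1}FE app_mul; exact: app_scale.
Qed.

End ConeAutomorphisms.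

Theorem theorem2p1 (R : realType) (n : nat) (hn : (0 < n)%N)
    (f : ('I_n.+1 -> R[i]) -> ('I_n.+1 -> R[i]))
    (hf : biholomorphic_self_map (@Cn1 R n) f) :
  exists (c : ('I_n -> R[i]) -> R[i]) (A : 'M[R[i]]_n.+1),
    [/\ holomorphic_on (@ball_n R n) c,
        (forall w, ball_n w -> c w != 0),
        in_Un1 A,
        (forall z, Cn1 z ->
           f z ord0 = c (fun k => z (lift ord0 k) / z ord0) * z ord0)
        \/
        (forall z, Cn1 z ->
           f z ord0 = c (fun k => z (lift ord0 k) / z ord0) * (z ord0)^-1) &
        forall z, Cn1 z -> forall i : 'I_n,
          f z (lift ord0 i) =
            f z ord0 * ((\sum_(j < n.+1) A (lift ord0 i) j * z j)
                        / (\sum_(j < n.+1) A ord0 j * z j))].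
Proof.
case: hf => fC holf [g [gC holg gf fg]].
have Hf := holomorphic_lineholo holf; have Hg := holomorphic_lineholo holg.
have [A AU fA] := projective_linear holf Hg fC gC gf.
exists (fun w => f (ext 1 w) ord0), A; split=> //.
- exact: holomorphic_section.
- by move=> w hw; exact/Cn1_neq0/fC/Cn1_ext.
- exact: uniform_dichotomy Hf Hg fC gC gf fg.
move=> z hz i; have f0 := Cn1_neq0 (fC _ hz); have [b fE] := fA z hz.
rewrite -!/(app A z _); move: f0; rewrite fE /scale mulf_eq0 negb_or => /andP[_ A0].
by rewrite -mulrA [X in _ = b * X]mulrC divfK.
Qed.
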